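(* Let $k$ be a field of characteristic zero, let $K=k(t)$ be the rational function field, let $p\geq 3$ be a prime, and let $$\phi_p(x)=x^p+\left(\frac{-pt^p-pt}{pt^{p-1}+p-1}\right)x^{p-1}+t .$$ Then $G_K(\phi_p)=\mathrm{Aut}(T_p)$, i.e. the arboreal representation of $\phi_p$ is surjective.
   Context: For a polynomial $\phi\in K[x]$ of degree $d\geq 2$ all of whose iterates $\phi^n$ ($n\ge 1$) have non-zero discriminant, let $T_d$ be the infinite $d$-ary rooted tree whose vertices are the iterated preimages of $0$ under $\phi$ in $\overline{K}$ (level $n$ consists of the roots of $\phi^n$, with root vertex $0$ at level $0$), where a vertex $\alpha$ at level $n\ge 1$ is joined to the vertex $\phi(\alpha)$ at level $n-1$. Let $K_n(\phi)$ be the splitting field of $\phi^n$ over $K$, let $G_{K,n}(\phi)=\mathrm{Gal}(K_n(\phi)/K)$, and let $G_K(\phi)=\varprojlim G_{K,n}(\phi)$ with respect to restriction. Since Galois commutes with evaluation of $\phi$, $G_K(\phi)$ embeds in the group $\mathrm{Aut}(T_d)$ of rooted tree automorphisms; this subgroup is called the image of the arboreal representation of $\phi$. *)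

(* Defs.v *)
From HB Require Import structures.
From mathcomp Require Import all_boot all_order all_algebra all_field.

Set Implicit Arguments.
Unset Strict Implicit.
Unset Printing Implicit Defensive.

Import GRing.Theory.
Local Open Scope ring_scope.

Definition iter_poly (R : nzRingType) (phi : {poly R}) (n : nat) : {poly R} :=
  iter n (fun q => phi \Po q) 'X.

(* disc f = (-1)^(m(m-1)/2) Res(f, f') / lc(f) with m = deg f; MathComp has
   only the resultant.  Intended for deg f' = deg f - 1 (e.g. characteristic
   zero), since MathComp's Sylvester matrix uses the actual size of f'. *)
Definition discriminant (F : fieldType) (f : {poly F}) : F :=
  (-1) ^+ 'C((size f).-1, 2) * resultant f f^`() / lead_coef f.

Section Arboreal.

(* iota : K -> Kbar is meant to be an algebraic closure of K; algebraicity of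
   Kbar over K is a hypothesis of the theorem. *)
Variables (K : fieldType) (Kbar : closedFieldType).
Variables (iota : {rmorphism K -> Kbar}) (phi : {poly K}).

(* A vertex is a pair (level n, root of phi^n in Kbar); recording the level
   keeps the levels disjoint. *)
Definition is_vertex (v : nat * Kbar) : bool :=
  root (map_poly iota (iter_poly phi v.1)) v.2.

Definition tree_vertex : Type := {v : nat * Kbar | is_vertex v}.

Lemma root_is_vertex : is_vertex (0%N, 0).
Proof. by rewrite /is_vertex /= map_polyX rootX. Qed.

Definition tree_root : tree_vertex := exist _ (0%N, 0) root_is_vertex.

Definition level (v : tree_vertex) : nat := (val v).1.
Definition point (v : tree_vertex) : Kbar := (val v).2.

Definition child_of (u v : tree_vertex) : bool :=
  (level u == (level v).+1) && (point v == (map_poly iota phi).[point u]).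

Definition adjacent (u v : tree_vertex) : bool := child_of u v || child_of v u.

Definition tree_automorphism (f : tree_vertex -> tree_vertex) : Prop :=
  [/\ bijective f, f tree_root = tree_root
    & forall u v, adjacent (f u) (f v) = adjacent u v].

(* The splitting fields K_n(phi), as finite extensions of K given with their
   inclusions in Kbar. *)
Record splitting_tower : Type := SplittingTower {
  Kn : nat -> splittingFieldType K;
  Kn_incl : forall n, {rmorphism Kn n -> Kbar};
  Kn_inclA : forall n (a : K), Kn_incl n a%:A = iota a;
  Kn_split : forall n,
    splittingFieldFor 1 (map_poly (in_alg (Kn n)) (iter_poly phi n)) {:Kn n}
}.

Variable L : splitting_tower.

(* G_K(phi), the inverse limit of the Gal(K_n(phi) / K): coherence says that
   sigma_(n+1) restricts to sigma_n on K_n(phi), seen inside K_(n+1)(phi)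
   through the inclusions in Kbar. *)
Record arboreal_group : Type := ArborealGroup {
  gal_comp : forall n, gal_of {:Kn L n};
  gal_compP : forall n, gal_comp n \in 'Gal({:Kn L n} / 1)%g;
  gal_coherent : forall n (x : Kn L n) (y : Kn L n.+1),
    Kn_incl L n.+1 y = Kn_incl L n x ->
    Kn_incl L n.+1 (gal_comp n.+1 y) = Kn_incl L n (gal_comp n x)
}.

(* g acts on the tree as f: a vertex of level n is (the image in Kbar of) some
   x in K_n(phi), and f sends it to g x, at the same level. *)
Definition acts_as (g : arboreal_group) (f : tree_vertex -> tree_vertex) :
  Prop :=
  forall v : tree_vertex, level (f v) = level v /\
    exists2 x : Kn L (level v), Kn_incl L (level v) x = point v
      & point (f v) = Kn_incl L (level v) (gal_comp g (level v) x).

Definition arboreal_image (f : tree_vertex -> tree_vertex) : Prop :=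
  exists g : arboreal_group, acts_as g f.

End Arboreal.

Definition ratfun_t (k : fieldType) : {fraction {poly k}} :=
  tofrac ('X : {poly k}).

Definition phi_p (k : fieldType) (p : nat) : {poly {fraction {poly k}}} :=
  let t := ratfun_t k in
  'X^p
  + ((- p%:R * t ^+ p - p%:R * t) / (p%:R * t ^+ p.-1 + p%:R - 1))%:P
    * 'X^(p.-1)
  + t%:P.

(* Main.v *)
Require Import Defs.
From mathcomp Require Import all_boot all_order all_algebra all_fingroup all_field.
From mathcomp Require Import ring.
From mathcomp Require mpoly.
From Stdlib Require Import Classical ClassicalEpsilon.

(** Write phi for the polynomial and a_m = phi^m(0). The critical points of phi
are 0, of multiplicity p - 2, and a point c; the coefficients are chosen so that
0 -> t -> c under phi. Hence phi^m(c) = a_(m+2), and a specialization of phi^n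
has a multiple root only where some a_m vanishes.

The image is everything because, on each level n >= 1 of the tree, Galois acts
transitively and some Galois element is a single transposition of the roots of
phi^n (level_transitive, level_transposition). The transposed roots are
siblings, as p >= 3. The relation `the transposition of i and i' is Galois' is
an invariant equivalence, so the p siblings of a family split into classes of
equal size; since p is prime, all transpositions of siblings are Galois
(sibling_perm_mem). If a Galois element already agrees with a given tree
automorphism on level n, what remains to be corrected on level n + 1 permutes
siblings, hence is Galois (compatible_maps_realized). The elements found on the
various levels are coherent because a splitting field is generated by roots.

Transitivity is an Eisenstein argument at t = 0: there phi becomes x^p, while
phi^n(0) has a simple zero (Eisenstein_transitive).

For the transposition one needs a point tau at which a_(n+2) has a simple zero
whereas a_1, ..., a_(n+1) and the denominators do not vanish. It is found by
reducing modulo p, where phi becomes x^p + t: up to sign, the numerator of a_m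
becomes a polynomial of degree p^(m-1) with derivative 1. It is thus squarefree,
and too large to divide the product of the earlier ones (primitive_simple_zero).

At t = tau exactly two roots of phi^n collide, namely at c, and the discriminant
of phi^n vanishes there to odd order. The usual conclusion is that inertia at
tau is generated by a transposition. It is obtained here without extending
valuations (transposition_of_odd_discriminant). The theorem on symmetric
polynomials gives a labelling of the specialized roots that respects all
polynomial relations over k[t] among the roots. If no Galois permutation were
the transposition of the two colliding labels, the Galois permutations would
move the specialized roots to pairwise distinct tuples, and by interpolation
some alternating Galois sum u of a monomial would not vanish at tau. Both u^2
and u times the Vandermonde determinant are then rational functions, so that the
discriminant is a square divided by a function regular and non-zero at tau,
against its odd order. *)

Set Implicit Arguments.
Unset Strict Implicit.
Unset Printing Implicit Defensive.

(** * Permutation groups preserving sibling families of prime size *)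

Section SiblingPermutations.
Local Open Scope group_scope.
Variables (T : finType) (U : eqType) (par : T -> U) (A : {group {perm T}}).
Variable p : nat.
Hypotheses (p_prime : prime p) (p_ge3 : 3 <= p).
Hypothesis transA : forall i j, exists2 s : {perm T}, s \in A & s i = j.
Hypothesis parA : forall (s : {perm T}) i j,
  s \in A -> par i = par j -> par (s i) = par (s j).
Hypothesis fibreA : forall i, #|[set j | par j == par i]| = p.

Let e i j := tperm i j \in A.

Let e_refl i : e i i. Proof. by rewrite /e tperm1 group1. Qed.

Let e_sym i j : e i j = e j i. Proof. by rewrite /e tpermC. Qed.

Let e_conj (s : {perm T}) i j : s \in A -> e i j -> e (s i) (s j).
Proof. by move=> sA eij; rewrite /e -tpermJ groupJ. Qed.

Let e_trans i j l : e i j -> e j l -> e i l.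
Proof.
move=> eij ejl; have [->//|nij] := eqVneq i j.
have [<-//|nil] := eqVneq i l.
have := e_conj ejl eij; rewrite tpermL tpermD //; by rewrite eq_sym.
Qed.

(** A transposition of the group that exchanged members of two families would fix
a third member of the first family, and so could not move that family. *)
Lemma tperm_mem_sibling i j : tperm i j \in A -> par i = par j.
Proof.
move=> eij; have [->//|nij] := eqVneq i j.
have : 0 < #|[set l | par l == par i] :\ i :\ j|.
  have := cardsD1 i [set l | par l == par i]; rewrite fibreA inE eqxx.
  have := cardsD1 j ([set l | par l == par i] :\ i).
  by move=> -> ep; move: p_ge3; rewrite ep; case: (_ \in _); case: #|_|.
case/card_gt0P => l; rewrite !inE => /and3P[nlj nli /eqP pl].
have := parA eij pl; rewrite tpermD 1?eq_sym // tpermL pl //.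
Qed.

(** Being exchanged by a transposition of the group is an equivalence relation,
invariant under a transitive group. All its classes have the same size, which
divides the prime size of a family; so each family is a single class. *)
Lemma sibling_perm_mem i0 i1 (pi : {perm T}) :
  i0 != i1 -> tperm i0 i1 \in A -> (forall i, par (pi i) = par i) -> pi \in A.
Proof.
move=> ni01 t01.
pose C i := [set j | e i j].
have cardC i j : #|C i| = #|C j|.
  have [s sA <-] := transA i j.
  suff -> : C (s i) = s @: C i by rewrite card_imset //; apply: perm_inj.
  apply/setP=> l; rewrite inE; apply/idP/imsetP.
    move=> h; exists (s^-1 l); last by rewrite permKV.
    by rewrite inE -[i](permK s) e_conj ?groupV.
  by case=> l'; rewrite inE => h ->; apply: e_conj.
have gt1 i : 1 < #|C i|.
  rewrite (cardC i i0) (leq_trans (_ : 1 < #|[set i0; i1]|)) //.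
    by rewrite cards2 ni01.
  by apply/subset_leq_card/subsetP => l; rewrite !inE => /pred2P[]->.
have all_sib i j : par i = par j -> e i j.
  pose F := [set l | par l == par i].
  have eqe : {in F & &, equivalence_rel e}.
    move=> x y z _ _ _; split=> // exy; apply/idP/idP => h.
      by apply: e_trans h; rewrite e_sym.
    exact: e_trans h.
  have CF x : x \in F -> C x \subset F.
    rewrite inE => /eqP xF; apply/subsetP=> y; rewrite !inE -xF => exy.
    by rewrite (tperm_mem_sibling exy).
  have := card_uniform_partition (n := #|C i|) _ (equivalence_partitionP eqe).
  have -> : #|F| = p by rewrite fibreA.
  move=> H; have {H} cp : p = (#|equivalence_partition e F| * #|C i|)%N.
    apply: H => B /imsetP[x xF ->]; rewrite (cardC i x); apply: eq_card => y.
    rewrite !inE andb_idl // => exy; have /subsetP := CF _ xF; move/(_ y).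
    by rewrite !inE; apply.
  have cC : #|C i| = p.
    have : #|C i| %| p by rewrite [X in _ %| X]cp dvdn_mull.
    by case/primeP: p_prime => _ h /h/pred2P[] // h1; have := gt1 i; rewrite h1.
  have : C i = F.
    apply/eqP; rewrite eqEcard CF ?inE ?eqxx //= cC fibreA //.
  by move/setP/(_ j); rewrite !inE => -> /eqP; rewrite eq_sym.
have [n] := ubnP #|[set i | pi i != i]|; elim: n pi => // n IHn pi le_n sib.
have [/eqP->|] := boolP (pi == 1); first exact: group1.
rewrite -[_ == _]negbK => /negP pin1.
have [i pii] : exists i, pi i != i.
  apply/existsP; apply: contraT; rewrite negb_exists => /forallP h.
  case: pin1; rewrite negbK; apply/eqP/permP => i; rewrite perm1.
  by apply/eqP; rewrite -[_ == _]negbK h.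
have tA : tperm i (pi i) \in A by apply: all_sib; rewrite sib.
rewrite -(groupMr _ tA); apply: IHn; last first.
  move=> l; rewrite permM; case: tpermP => [h|h|//]; last by rewrite -(sib l) h.
  by rewrite sib -[in RHS]sib h.
apply: leq_trans (_ : #|[set j | pi j != j]| <= _) => //.
apply: proper_card; apply/properP; split.
  apply/subsetP => l; rewrite !inE permM; case: tpermP => // [h _|/perm_inj ->].
    by apply: contraNneq pii => il; rewrite -h !il.
  by rewrite eqxx.
by exists i; rewrite !inE // permM tpermR eqxx.
Qed.
End SiblingPermutations.

Import GRing.Theory.
Local Open Scope ring_scope.

(** * Symmetric functions and specialization *)

Module SymmetricFunctions.
Import mpoly.

Section Evaluation.
Variables (R S : idomainType) (f : {rmorphism R -> S}) (M : nat).
Implicit Types (v : 'I_M -> S) (h : {mpoly R[M]}).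

Lemma mmap_msym v (s : 'S_M) h :
  mmap f v (msym s h) = mmap f (fun i => v (s i)) h.
Proof.
rewrite [h]mpolyE (raddf_sum (msym s)) !raddf_sum /=; apply: eq_bigr => m _.
rewrite msymZ msymX !mmapZ !mmapX; congr (_ * _).
rewrite /mmap1 (reindex_inj (@perm_inj _ s)) /=; apply: eq_bigr => i _.
by rewrite mnmE permK.
Qed.

Lemma mmap_mesym v k : mmap f v (mesym M R k) = (mesym M S k).@[v].
Proof.
rewrite /mesym !raddf_sum /=; apply: eq_bigr => i _.
rewrite !rmorph_prod /=; apply: eq_bigr => j _.
by rewrite mmapX mmap1U mevalXU.
Qed.

Lemma mmap_comp_mpoly v (t : {mpoly R[M]}) (lq : M.-tuple {mpoly R[M]}) w :
  (forall i, mmap f v (tnth lq i) = f (w i)) ->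
  mmap f v (t \mPo lq) = f t.@[w].
Proof.
move=> hw; rewrite comp_mpolyEX raddf_sum mevalE rmorph_sum /=.
apply: eq_bigr => m _; rewrite mmapZ comp_mpolyX rmorph_prod rmorphM.
congr (_ * _); rewrite rmorph_prod; apply: eq_bigr => i _.
by rewrite !rmorphXn /= hw.
Qed.
End Evaluation.

(** The point is that r depends on neither the morphism nor the roots: it is
obtained by evaluating h, written in the elementary symmetric polynomials, at the
signed coefficients of P. *)
Lemma symmetric_value (R : idomainType) M (P : {poly R}) (h : {mpoly R[M]}) :
    h \is symmetric ->
  exists r, forall (S : idomainType) (f : {rmorphism R -> S}) (v : 'I_M -> S),
    map_poly f P = \prod_(i < M) ('X - (v i)%:P) -> mmap f v h = f r.
Proof.
case/sym_fundamental => t [<- _].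
exists (t.@[fun i : 'I_M => (-1) ^+ i.+1 * P`_(M - i.+1)]) => S f v Pv.
apply: mmap_comp_mpoly => i; rewrite tnth_mktuple mmap_mesym.
have iM : (i.+1 < M.+1)%N by rewrite ltnS.
have := mroots_coeff [tuple v i | i < M] (Ordinal iM).
rewrite big_tuple /=; under eq_bigr do rewrite tnth_mktuple.
rewrite -Pv coef_map rmorphM rmorphXn rmorphN1 /= => ->.
rewrite mulrA -exprD addnn -mul2n exprM sqrrN !expr1n mul1r.
by apply: meval_eq => j; rewrite tnth_mktuple.
Qed.

(** Extends the specialization g to the roots of P, in place of a prime above the
kernel of g. If every labelling s violated some relation h s, the polynomial
combining the h s in a new variable, multiplied over all permutations, would have
symmetric coefficients: these vanish at v, hence at w by symmetric_value, yet no
factor vanishes at w. *)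
Lemma specialization_labelling (R S W : idomainType) (f : {rmorphism R -> S})
    (g : {rmorphism R -> W}) M (P : {poly R}) (v : 'I_M -> S) (w : 'I_M -> W) :
    injective f ->
    map_poly f P = \prod_(i < M) ('X - (v i)%:P) ->
    map_poly g P = \prod_(i < M) ('X - (w i)%:P) ->
  exists s : 'S_M, forall h : {mpoly R[M]},
    mmap f v h = 0 -> mmap g (fun i => w (s i)) h = 0.
Proof.
move=> inj_f Pv Pw; apply: NNPP => no_s.
have /fin_all_exists2[h hv hw] (s : 'S_M) :
    exists2 h, mmap f v h = 0 & mmap g (fun i => w (s i)) h <> 0.
  apply: NNPP => noh; apply: no_s; exists s => h hv.
  by apply: NNPP => hw; apply: noh; exists h.
(* One power of the variable for each labelling keeps the h s apart. *)
pose H : {poly {mpoly R[M]}} :=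
  \sum_(s : 'S_M) (h s)%:P * 'X^(enum_rank s).
have coefH (s : 'S_M) : H`_(enum_rank s) = h s.
  rewrite coef_sum (bigD1 s) //= coefCM coefXn eqxx mulr1 big1 ?addr0 // => s' ns.
  rewrite coefCM coefXn (inj_eq val_inj) (inj_eq enum_rank_inj) eq_sym.
  by rewrite (negbTE ns) mulr0.
pose Q := \prod_(s : 'S_M) map_poly (msym s) H.
have symQ k : Q`_k \is symmetric.
  apply/issymP => s; rewrite -coef_map; suff -> : map_poly (msym s) Q = Q by [].
  rewrite rmorph_prod [LHS](reindex_inj (mulIg s^-1)%g) /=.
  apply: eq_bigr => s' _; apply/polyP => i; rewrite !coef_map /=.
  by rewrite -msymMm mulgKV.
have Q0 : map_poly (mmap f v) Q = 0.
  rewrite rmorph_prod (bigD1 1%g) //=; apply/eqP; rewrite mulf_eq0.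
  apply/orP; left; apply/eqP/polyP => k; rewrite coef0 !coef_map /= msym1m.
  rewrite coef_sum rmorph_sum big1 //= => s _.
  by rewrite coefCM rmorphM /= hv mul0r.
have : map_poly (mmap g w) Q != 0.
  rewrite rmorph_prod; apply/prodf_neq0 => s _.
  apply: contra_notN (hw s) => /eqP/polyP/(_ (enum_rank s)).
  by rewrite coef0 !coef_map /= coefH mmap_msym.
case/eqP; apply/polyP => k; rewrite coef0 coef_map /=.
have [r hr] := symmetric_value P (symQ k).
rewrite (hr _ _ _ Pw); suff -> : r = 0 by rewrite rmorph0.
apply: inj_f; rewrite -(hr _ _ _ Pv) rmorph0.
by have /polyP/(_ k) := Q0; rewrite coef0 coef_map.
Qed.

(** Lagrange interpolation: a polynomial vanishing at all the points except one has
a non-zero weighted sum of values, and so one of its monomials has too. *)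
Lemma separating_monomial (W : idomainType) M (I : finType) (A : {pred I})
    (i0 : I) (x : I -> 'I_M -> W) (c : I -> W) :
    i0 \in A -> (forall i, i \in A -> x i =1 x i0 -> i = i0) -> c i0 != 0 ->
  exists m : 'I_M -> nat,
    \sum_(i in A) c i * \prod_(k < M) x i k ^+ m k != 0.
Proof.
move=> Ai0 inj_x c0.
have /fin_all_exists[q hq] i : exists q : {mpoly W[M]},
    (i \in A -> i != i0 -> q.@[x i] = 0) /\ q.@[x i0] != 0.
  have [/andP[Ai ni]|nA] := boolP ((i \in A) && (i != i0)); last first.
    exists 1; rewrite !meval1 oner_neq0; split=> // Ai ni.
    by rewrite Ai ni in nA.
  have [k hk] : exists k, x i k != x i0 k.
    apply/existsP; apply: contraNT ni; rewrite negb_exists => /forallP h.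
    by apply/eqP/inj_x => // k; apply/eqP; rewrite -[_ == _]negbK h.
  exists ('X_k - (x i k)%:MP); rewrite !rmorphB /= !mevalXU !mevalC subrr.
  by split=> [_ _|] //; rewrite subr_eq0 eq_sym.
pose h := \prod_(i | i != i0) q i.
have h0 : \sum_(i in A) c i * h.@[x i] != 0.
  rewrite (bigD1 i0) //= big1 ?addr0 => [|i /andP[Ai ni]].
    by rewrite mulf_neq0 // rmorph_prod; apply/prodf_neq0 => i _; case: (hq i).
  by rewrite rmorph_prod (bigD1 i) //= (hq i).1 // mul0r mulr0.
apply: NNPP => no_m; case/eqP: h0.
under eq_bigr => i _ do rewrite mevalE mulr_sumr.
rewrite exchange_big big1 // => m _ /=.
under eq_bigr => i _ do rewrite mulrCA.
rewrite -mulr_sumr; apply/eqP; rewrite mulf_eq0; apply/orP; right.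
by apply: contra_notT no_m => nz; exists m.
Qed.
End SymmetricFunctions.
Import SymmetricFunctions.

(** * Galois groups as permutation groups of roots *)

Lemma root_prod_XsubC_mem (R : comNzRingType) (I : finType) (x : I -> R) i :
  root (\prod_i ('X - (x i)%:P)) (x i).
Proof.
by rewrite /root horner_prod (bigD1 i) //= hornerXsubC subrr mul0r.
Qed.

Lemma prod_up_to_sign (R : comNzRingType) (I : finType) (A : pred I) (F G : I -> R) :
    (forall i, exists b : bool, F i = (-1) ^+ b * G i) ->
  exists b : bool, \prod_(i | A i) F i = (-1) ^+ b * \prod_(i | A i) G i.
Proof.
move=> FG; elim/big_ind2: _ => [|x1 x2 y1 y2 [b1 ->] [b2 ->]|i _] //.
  by exists false; rewrite mulr1.
by exists (b1 (+) b2); rewrite signr_addb mulrACA.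
Qed.

Section RootPermutations.
Variables (F : fieldType) (E : splittingFieldType F) (M : nat).
Variables (P : {poly F}) (al : 'I_M -> E).
Hypotheses (al_inj : injective al)
  (Pal : map_poly (in_alg E) P = \prod_(i < M) ('X - (al i)%:P)).
Local Notation G := 'Gal({:E} / 1)%g.

Lemma gal_in_alg (g : gal_of {:E}) (a : F) : g \in G -> g a%:A = a%:A.
Proof. by move=> gG; rewrite (fixed_gal (sub1v _) gG) ?rpredZ ?rpred1. Qed.

Lemma gal_map_in_alg (g : gal_of {:E}) (Q : {poly F}) : g \in G ->
  map_poly g (map_poly (in_alg E) Q) = map_poly (in_alg E) Q.
Proof.
by move=> gG; apply/polyP => i; rewrite !coef_map /= gal_in_alg.
Qed.

Lemma root_in_codom x : root (map_poly (in_alg E) P) x -> exists i, x = al i.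
Proof.
rewrite Pal /root horner_prod prodf_seq_eq0 => /hasP[i _].
by rewrite hornerXsubC subr_eq0 => /eqP ->; exists i.
Qed.

Lemma codom_root i : root (map_poly (in_alg E) P) (al i).
Proof. by rewrite Pal root_prod_XsubC_mem. Qed.

Lemma gal_root_perm (g : gal_of {:E}) : g \in G ->
  exists s : 'S_M, forall i, g (al i) = al (s i).
Proof.
move=> gG.
have /fin_all_exists[s hs] i : exists j, g (al i) = al j.
  apply: root_in_codom; rewrite -(gal_map_in_alg P gG).
  by rewrite fmorph_root codom_root.
have s_inj : injective s.
  move=> i j eq_s; apply/al_inj/(fmorph_inj g).
  by rewrite [LHS]hs [RHS]hs eq_s.
by exists (perm s_inj) => i; rewrite permE.
Qed.

Definition root_perms : {set 'S_M} :=
  [set s : 'S_M | [exists g in G, [forall i, g (al i) == al (s i)]]].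

Lemma root_permsP (s : 'S_M) :
  reflect (exists2 g, g \in G & forall i, g (al i) = al (s i)) (s \in root_perms).
Proof.
rewrite inE; apply: (iffP exists_inP) => -[g gG].
  by move/forallP=> h; exists g => // i; apply/eqP.
by move=> h; exists g => //; apply/forallP => i; apply/eqP.
Qed.

Lemma root_perms_group_set : group_set root_perms.
Proof.
apply/group_setP; split.
  by apply/root_permsP; exists 1%g => // i; rewrite perm1 gal_id.
move=> s t /root_permsP[g gG hg] /root_permsP[h hG hh].
apply/root_permsP; exists (g * h)%g; first exact: groupM.
by move=> i; rewrite galM ?memvf // permM hg hh.
Qed.
Canonical root_perms_group := Group root_perms_group_set.

Hypothesis galE : galois 1 {:E}.

Lemma gal_fixed_in_alg x : (forall g, g \in G -> g x = x) -> exists a : F, x = a%:A.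
Proof.
move=> h; have /vlineP[a ->] : x \in 1%VS; last by exists a.
by rewrite -(galois_fixedField galE); apply/fixedFieldP; rewrite ?memvf.
Qed.

(** Galois permutes the columns of the matrix. *)
Lemma gal_Vandermonde g (s : 'S_M) : g \in G -> (forall i, g (al i) = al (s i)) ->
  let d := \det (Vandermonde M (\row_i al i)) in g d = (-1) ^+ s * d.
Proof.
move=> gG gs /=; rewrite -det_map_mx.
have -> : map_mx g (Vandermonde M (\row_i al i))
        = col_perm s (Vandermonde M (\row_i al i)).
  by apply/matrixP => i j; rewrite !mxE rmorphXn /= gs.
by rewrite col_permE det_mulmx det_perm odd_permV mulrC.
Qed.
End RootPermutations.

Lemma Vandermonde_sqr (R : comNzRingType) M (x : 'I_M -> R) : exists b : bool,
  \det (Vandermonde M (\row_i x i)) ^+ 2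
  = (-1) ^+ b * \prod_i \prod_(j | j != i) (x i - x j).
Proof.
rewrite det_Vandermonde.
set d := (X in X ^+ 2).
have split_prod : \prod_i \prod_(j | j != i) (x i - x j)
  = d * \prod_(i < M) \prod_(j < M | (i < j)%N) (x i - x j).
  have -> : d = \prod_(i < M) \prod_(j < M | (j < i)%N) (x i - x j).
    rewrite /d (exchange_big_dep xpredT) //=; apply: eq_bigr => i _.
    by apply: eq_big => // j _; rewrite !mxE.
  rewrite -big_split; apply: eq_bigr => i _.
  rewrite (bigID (fun j : 'I_M => (j < i)%N)) /=; congr (_ * _).
    by apply: eq_bigl => j; rewrite -val_eqE; case: ltngtP.
  by apply: eq_bigl => j; rewrite -val_eqE; case: ltngtP.
have [b hb] : exists b : bool, \prod_(i < M) \prod_(j < M | (i < j)%N) (x i - x j)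
   = (-1) ^+ b * d.
  apply: prod_up_to_sign => i; apply: prod_up_to_sign => j.
  by exists true; rewrite !mxE expr1 mulN1r opprB.
by exists b; rewrite split_prod hb [d * _]mulrCA signrMK expr2.
Qed.

(** * A transposition from a discriminant of odd order *)

(** Inertia at a simple collision: a permutation compatible with the collision can
only exchange the two colliding labels. *)
Lemma collision_perm (W : eqType) M (w : 'I_M -> W) (c : W) (s : 'S_M) :
    #|[set i | w i == c]| = 2 ->
    (forall i i', w i = w i' -> i = i' \/ w i = c) ->
    (forall i, w (s i) = w i) ->
  s = 1%g \/ exists i1 i2, i1 != i2 /\ s = tperm i1 i2.
Proof.
move=> w_c w_inj ws; have [/eqP s1|ns] := boolP (s == 1%g).
  by left.
right.
have sfix i : w i != c -> s i = i.
  by case: (w_inj _ _ (ws i)) => // h; rewrite -(ws i) h eqxx.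
have /cards2P[i1 [i2 [n12 Cc]]] : #|[set i | w i == c]| == 2 by rewrite w_c.
have wc i : (w i == c) = (i == i1) || (i == i2).
  by move/setP/(_ i): Cc; rewrite !inE.
exists i1, i2; split=> //.
have s1 : s i1 \in [:: i1; i2] by rewrite !inE -wc ws wc eqxx.
have s2 : s i2 \in [:: i1; i2] by rewrite !inE -wc ws wc eqxx orbT.
have s12 : s i1 != s i2 by rewrite (inj_eq perm_inj).
have e1 : s i1 = i2.
  move: s1 s2 s12; rewrite !inE => /pred2P[]// e1 /pred2P[] e2.
    by rewrite e1 e2 eqxx.
  case/eqP: ns; apply/permP => i; rewrite perm1.
  have [|/sfix//] := boolP (w i == c); rewrite wc.
  by case/pred2P=> ->.
have e2 : s i2 = i1.
  by move: s2 s12; rewrite !inE e1 => /pred2P[]// ->; rewrite eqxx.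
apply/permP => i; case: tpermP => [->|->|n1 n2] //.
by apply: sfix; rewrite wc; apply/norP; split; apply/eqP.
Qed.

Section Transposition.
Import mpoly.
Variables (R : idomainType) (F : fieldType) (W : idomainType).
Variables (j : {rmorphism R -> F}) (rho : {rmorphism R -> W}).
Variables (E : splittingFieldType F) (M : nat) (P : {poly R}).
Variables (al : 'I_M -> E) (w : 'I_M -> W) (c : W) (D : F).
Hypotheses (j_inj : injective j)
  (j_closed : forall z : F, integralOver j z -> exists r, z = j r)
  (galE : galois 1 {:E}) (P_monic : P \is monic) (al_inj : injective al)
  (Pal : map_poly (in_alg E) (map_poly j P) = \prod_(i < M) ('X - (al i)%:P))
  (Pw : map_poly rho P = \prod_(i < M) ('X - (w i)%:P))
  (w_c : #|[set i | w i == c]| = 2)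
  (w_inj : forall i i', w i = w i' -> i = i' \/ w i = c)
  (discP : D%:A = \prod_i \prod_(i' | i' != i) (al i - al i'))
  (odd_disc : forall r z, rho r != 0 -> z ^+ 2 != j r * D).
Local Notation G := 'Gal({:E} / 1)%g.

(** If the permutation group contained no transposition, the tuples of specialized
roots that it produces would be pairwise distinct by collision_perm, and
separating_monomial would give an alternating sum u with non-zero
specialization. As u^2 and u times the Vandermonde determinant d are fixed by
Galois, the discriminant d^2 would be a rational square up to an element with
non-zero specialization. *)
Lemma transposition_of_odd_discriminant :
  exists i1 i2, i1 != i2 /\ tperm i1 i2 \in root_perms al.
Proof.
pose f : {rmorphism R -> E} := in_alg E \o j.
have f_inj : injective f by move=> a b /fmorph_inj/j_inj.
have Pal' : map_poly f P = \prod_(i < M) ('X - (al i)%:P).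
  by rewrite -Pal -map_poly_comp.
have [s hs] := specialization_labelling f_inj Pal' Pw.
pose w' i := w (s i).
pose A := root_perms_group al.
apply: NNPP => no_t.
have [m hm] : exists m : 'I_M -> nat,
    \sum_(t in A) (-1) ^+ t * \prod_(k < M) w' (t k) ^+ m k != 0.
  apply: (@separating_monomial _ _ _ (mem A) 1%g (fun t k => w' (t k))
           (fun t : 'S_M => (-1) ^+ t)) => [|t tA wt|].
  - exact: group1.
  - case: (@collision_perm _ _ w' c t) => [| | |//|[i1 [i2 [n12 Dt]]]].
    + rewrite -w_c -[RHS](card_preimset _ (@perm_inj _ s)).
      by apply: eq_card => i; rewrite !inE.
    + by move=> i i' /w_inj[/perm_inj|]; [left | right].
    + by move=> i; rewrite wt perm1.
    + by case: no_t; exists i1, i2; rewrite -Dt.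
  - by rewrite signr_eq0.
pose H : {mpoly R[M]} :=
  \sum_(t in A) (-1) ^+ t * \prod_(k < M) 'X_(t k) ^+ m k.
have valH (S : idomainType) (g : {rmorphism R -> S}) (v : 'I_M -> S) :
    mmap g v H = \sum_(t in A) (-1) ^+ t * \prod_(k < M) v (t k) ^+ m k.
  rewrite rmorph_sum; apply: eq_bigr => t _ /=.
  rewrite rmorphM rmorph_sign rmorph_prod /=; congr (_ * _).
  by apply: eq_bigr => k _; rewrite rmorphXn /= mmapX mmap1U.
set u := mmap f al H.
set d := \det (Vandermonde M (\row_i al i)).
have gu g (t : 'S_M) : g \in G -> (forall i, g (al i) = al (t i)) ->
    g u = (-1) ^+ t * u.
  move=> gG gt; have tA : t \in A by apply/root_permsP; exists g.
  rewrite /u valH rmorph_sum mulr_sumr (reindex_inj (mulIg t^-1)%g) /=.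
  apply: eq_big => [t'|t' _]; first by rewrite groupMr ?groupV.
  rewrite odd_permM odd_permV signr_addb rmorphM rmorphM !rmorph_sign rmorph_prod.
  rewrite [RHS]mulrA [(-1) ^+ t' * _]mulrC; congr (_ * _).
  by apply: eq_bigr => k _; rewrite rmorphXn /= gt permM permKV.
have [a ua] : exists a : F, u ^+ 2 = a%:A.
  apply: (gal_fixed_in_alg galE) => g gG; have [t gt] := gal_root_perm al_inj Pal gG.
  by rewrite rmorphXn /= (gu g t) // exprMn sqrr_sign mul1r.
have [z uz] : exists z : F, u * d = z%:A.
  apply: (gal_fixed_in_alg galE) => g gG; have [t gt] := gal_root_perm al_inj Pal gG.
  rewrite rmorphM /= (gu g t) // (gal_Vandermonde gG gt) mulrACA -signr_addb.
  by rewrite addbb mul1r.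
have u_int : integralOver f u.
  rewrite /u valH; apply: (big_ind (integralOver f)) => [|? ?|t _].
  - exact: integral0.
  - exact: integral_add.
  apply: integral_mul; first by rewrite -(rmorph_sign f); apply: integral_id.
  apply: (big_ind (integralOver f)) => [|? ?|k _].
  - exact: integral1.
  - exact: integral_mul.
  elim: (m k) => [|n IHn]; first exact: integral1.
  rewrite exprS; apply: integral_mul => //; exists P => //.
  by rewrite Pal' root_prod_XsubC_mem.
have [r ar] : exists r, a = j r.
  apply: j_closed; have [q q_mon] : integralOver f a%:A.
    by rewrite -ua; apply: integral_mul.
  by rewrite /f map_poly_comp fmorph_root => qa; exists q.
have rho_r : rho r != 0.
  have := hs (H ^+ 2 - r%:MP); rewrite !rmorphB !rmorphXn /= !mmapC.
  rewrite -/u ua ar subrr => /(_ erefl) /eqP; rewrite subr_eq0 => /eqP <-.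
  by rewrite expf_neq0 // valH.
have [b db] := Vandermonde_sqr al.
have := @odd_disc ((-1) ^+ b * r) z.
rewrite rmorphM rmorph_sign mulf_neq0 ?signr_eq0 //.
move=> /(_ isT)/eqP; apply; apply: (fmorph_inj (in_alg E)).
rewrite rmorphXn /= -uz exprMn ua db -discP ar rmorphM rmorph_sign.
rewrite -!in_algE !rmorphM rmorph_sign /= mulrCA !mulrA; congr (_ * _ * _).
Qed.
End Transposition.

(** * Transitivity by the Eisenstein argument *)

Section Eisenstein.
Variables (R : idomainType) (F : fieldType) (W : idomainType).
Variables (j : {rmorphism R -> F}) (e : {rmorphism R -> W}) (t : R).
Variables (E : splittingFieldType F) (M : nat) (P : {poly R}).
Variables (al : 'I_M -> E) (v : R).
Hypotheses (j_inj : injective j)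
  (j_closed : forall z : F, integralOver j z -> exists r, z = j r)
  (t0 : t != 0) (ker_e : forall r, e r = 0 <-> exists r', r = t * r')
  (galE : galois 1 {:E}) (P_monic : P \is monic) (al_inj : injective al)
  (Pal : map_poly (in_alg E) (map_poly j P) = \prod_(i < M) ('X - (al i)%:P))
  (Pe : map_poly e P = 'X^M) (P0 : P`_0 = t * v) (v0 : e v != 0).
Local Notation G := 'Gal({:E} / 1)%g.
Let f : {rmorphism R -> E} := in_alg E \o j.

Let Pal' : map_poly f P = \prod_(i < M) ('X - (al i)%:P).
Proof. by rewrite -Pal -map_poly_comp. Qed.

Let al_int i : integralOver f (al i).
Proof.
exists P => //.
by rewrite Pal' root_prod_XsubC_mem.
Qed.

Let integral_exp x n : integralOver f x -> integralOver f (x ^+ n).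
Proof.
move=> ix; elim: n => [|n IHn]; first exact: integral1.
by rewrite exprS; apply: integral_mul.
Qed.

Let integral_in_R (a : F) : integralOver f a%:A -> exists r, a = j r.
Proof.
case=> q q_mon; rewrite /f map_poly_comp fmorph_root => qa.
by apply: j_closed; exists q.
Qed.

(** All lower coefficients of P are divisible by t. *)
Lemma root_power_divisible i : exists2 g, integralOver f g & al i ^+ M = f t * g.
Proof.
have sizeP : size P = M.+1.
  rewrite -(size_map_poly_id0 (f := e)) ?Pe ?size_polyXn //.
  by rewrite (monicP P_monic) rmorph1 oner_neq0.
have /fin_all_exists[q hq] (k : 'I_M) : exists q, P`_k = t * q.
  apply/ker_e; rewrite -coef_map Pe coefXn; case: eqP => // kM.
  by have := ltn_ord k; rewrite kM ltnn.
exists (- \sum_(k < M) f (q k) * al i ^+ k).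
  apply/integral_opp/(big_ind (integralOver f)) => [|? ?|k _].
  - exact: integral0.
  - exact: integral_add.
  by apply: integral_mul; [apply: integral_id | apply: integral_exp].
have : root (map_poly f P) (al i).
  by rewrite Pal' root_prod_XsubC_mem.
rewrite /root horner_coef size_map_inj_poly ?rmorph0 //; last first.
  by move=> a b /fmorph_inj/j_inj.
have lP : (map_poly f P)`_M = 1.
  rewrite coef_map; have -> : P`_M = 1.
    by have /monicP := P_monic; rewrite /lead_coef sizeP.
  exact: rmorph1.
rewrite sizeP big_ord_recr /= lP mul1r addrC addr_eq0 => /eqP ->.
rewrite mulrN mulr_sumr; congr (- _); apply: eq_bigr => k _.
rewrite mulrA coef_map hq; congr (_ * _); exact: (rmorphM f).
Qed.

(** The product lies in R, and one of its powers is t times an integral element. *)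
Lemma stable_product_divisible (B : {set 'I_M}) :
    (forall s i, s \in root_perms al -> i \in B -> s i \in B) -> B != set0 ->
  exists2 r, \prod_(i in B) al i = f r & e r = 0.
Proof.
move=> stB /set0Pn[i0 Bi0].
have [a Ba] : exists a : F, \prod_(i in B) al i = a%:A.
  apply: (gal_fixed_in_alg galE) => g gG; have [s gs] := gal_root_perm al_inj Pal gG.
  have sA : s \in root_perms_group al by apply/root_permsP; exists g.
  rewrite rmorph_prod [RHS](reindex_inj (@perm_inj _ s)) /=.
  apply: eq_big => [i|i _]; last by rewrite gs.
  apply/idP/idP => [|Bsi]; first exact: stB.
  by rewrite -[i](permK s); apply: stB => //; apply: (groupVr sA).
have [r ar] : exists r, a = j r.
  apply: integral_in_R; rewrite -Ba; apply: (big_ind (integralOver f)) => //.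
  - exact: integral1.
  - exact: integral_mul.
exists r; first by rewrite Ba ar.
have [g ig rg] : exists2 g, integralOver f g & f (r ^+ M) = f t * g.
  rewrite rmorphXn /= -ar -Ba -prodrXl (bigD1 i0) //=.
  have [g ig ->] := root_power_divisible i0.
  exists (g * \prod_(i in B | i != i0) al i ^+ M); last by rewrite mulrA.
  apply: integral_mul => //; apply: (big_ind (integralOver f)) => [|? ?|k _].
  - exact: integral1.
  - exact: integral_mul.
  exact: integral_exp.
have jt0 : j t != 0 by rewrite -(rmorph0 j) (inj_eq j_inj).
have ft0 : f t != 0 by rewrite -[f t]/(in_alg E (j t)) fmorph_eq0.
have [q hq] : exists q, j (r ^+ M) / j t = j q.
  apply: integral_in_R; suff -> : (j (r ^+ M) / j t)%:A = g by [].
  apply: (mulfI ft0); rewrite -rg -[f t]/(in_alg E (j t)) -in_algE -rmorphM.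
  by rewrite mulrCA divff ?mulr1.
have : e (r ^+ M) = 0.
  apply/ker_e; exists q; apply: j_inj; rewrite rmorphM -hq mulrCA divff ?mulr1 //.
by rewrite rmorphXn => /eqP; rewrite expf_eq0 => /andP[_ /eqP].
Qed.

(** If the roots split into two stable parts, the constant coefficient of P is up to
sign a product of two elements divisible by t, whereas it is exactly divisible
by t once. *)
Lemma Eisenstein_transitive i1 i2 : exists2 s : 'S_M, s \in root_perms al & s i1 = i2.
Proof.
pose A := root_perms_group al.
pose B := [set i | [exists s in A, (s : 'S_M) i1 == i]].
have stB s i : s \in A -> (s i \in B) = (i \in B).
  have st s' i' : s' \in A -> i' \in B -> s' i' \in B.
    move=> sA; rewrite !inE => /exists_inP[u uA /eqP <-].
    by apply/exists_inP; exists (u * s')%g; rewrite ?groupM // permM.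
  move=> sA; apply/idP/idP; last exact: st.
  by move/(st s^-1%g); rewrite permK groupV; apply.
have Bi1 : i1 \in B.
  by rewrite inE; apply/exists_inP; exists 1%g; rewrite ?group1 // perm1.
have [|nB] := boolP (i2 \in B).
  by rewrite inE => /exists_inP[s sA /eqP]; exists s.
have [||r hr er] := @stable_product_divisible B.
- by move=> s i sA; rewrite stB.
- by apply/set0Pn; exists i1.
have [||r' hr' er'] := @stable_product_divisible (~: B).
- by move=> s i sA; rewrite !in_setC stB.
- by apply/set0Pn; exists i2; rewrite in_setC.
have /ker_e[q hq] := er; have /ker_e[q' hq'] := er'.
have P0v : f (t * v) = (-1) ^+ M * \prod_i al i.
  rewrite -P0 -coef_map Pal' -horner_coef0 horner_prod.
  rewrite (eq_bigr (fun i => - 1 * al i)) => [|i _].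
    by rewrite big_split prodr_const card_ord.
  by rewrite hornerXsubC sub0r mulN1r.
have : f (r * r') = (-1) ^+ M * f (t * v).
  rewrite P0v mulrA -exprMn mulrNN mulr1 expr1n mul1r.
  rewrite rmorphM -hr -hr' [RHS](bigID [in B]) /=; congr (_ * _).
  by apply: eq_bigl => i; rewrite in_setC.
rewrite -(rmorph_sign f) -rmorphM => /fmorph_inj/j_inj; rewrite hq hq'.
rewrite [LHS]mulrCA [RHS]mulrCA => eq_tv; have eq_v := mulfI t0 eq_tv.
case/eqP: v0; have : e ((-1) ^+ M * v) = 0.
  by apply/ker_e; exists (q * q'); rewrite -eq_v mulrA.
by rewrite rmorphM rmorph_sign => /eqP; rewrite mulf_eq0 signr_eq0 => /eqP.
Qed.
End Eisenstein.

(** * Rational functions: integral closure and parity of orders *)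

Section RationalFunctions.
Variable k : fieldType.
Local Notation K := {fraction {poly k}}.
Implicit Types (a b : {poly k}) (z : K).

Lemma fraction_quotient (R : idomainType) (z : {fraction R}) :
  exists a b : R, b != 0 /\ z = tofrac a / tofrac b.
Proof.
elim/quotP: z => x _.
exists (frac x).1, (frac x).2; rewrite denom_ratioP; split=> //.
have d0 : tofrac (frac x).2 != 0 by rewrite tofrac_eq0 denom_ratioP.
apply: (canRL (mulfK d0)).
unlock tofrac; rewrite -[LHS]FracField.pi_mul /FracField.mulf /=.
rewrite !numden_Ratio ?oner_neq0 // mulr1; apply/eqmodP => /=.
rewrite FracField.equivfE !numden_Ratio ?(oner_neq0, denom_ratioP, mulf_neq0) //.
by rewrite mulr1 mulrC.
Qed.

Lemma tofrac_inj (R : idomainType) : injective (@tofrac R).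
Proof. by move=> a b /eqP; rewrite tofrac_eq => /eqP. Qed.

Lemma reduced_quotient z :
  exists a b, [/\ b != 0, coprimep b a & z = tofrac a / tofrac b].
Proof.
have [a0 [b0 [b00 ->]]] := fraction_quotient z.
have [a [b [g [Da Db cab]]]] : exists a b g,
    [/\ a0 = a * g, b0 = b * g & coprimep b a].
  exists (a0 %/ gcdp a0 b0), (b0 %/ gcdp a0 b0), (gcdp a0 b0).
  by rewrite !divpK ?dvdp_gcdl ?dvdp_gcdr // coprimep_sym coprimep_div_gcd ?b00 ?orbT.
have : b * g != 0 by rewrite -Db.
rewrite mulf_eq0 negb_or => /andP[b_0 g0]; exists a, b; split=> //.
by rewrite Da Db !tofracM -mulf_div divff ?mulr1 ?tofrac_eq0.
Qed.

Lemma expr_cancel (F : fieldType) (y : F) i n : y != 0 -> (i <= n)%N ->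
  y ^+ (n - i) * y * y^-1 ^+ n.+1 = y^-1 ^+ i.
Proof.
move=> y0 le_in; rewrite -{2}(subnK le_in) -addSn exprD -exprSr mulrA -exprMn.
by rewrite divff // expr1n mul1r.
Qed.

(** The rational root argument: the reduced denominator divides a power of the
numerator. *)
Lemma poly_integrally_closed z :
  integralOver (@tofrac {poly k}) z -> exists a, z = tofrac a.
Proof.
have [a [b [b_0 cab ->]]] := reduced_quotient z.
have fb0 : tofrac b != 0 by rewrite tofrac_eq0.
case=> q q_mon; set n := (size q).-1.
have sq : size q = n.+1 by rewrite /n prednK // lt0n size_poly_eq0 monic_neq0.
move=> /rootP; rewrite horner_coef size_map_inj_poly ?rmorph0 //.
  2: exact: tofrac_inj.
have lq : (map_poly (@tofrac {poly k}) q)`_n = 1.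
  rewrite coef_map; have -> : q`_n = 1.
    by have /monicP := q_mon; rewrite /lead_coef sq.
  exact: rmorph1.
rewrite sq big_ord_recr /= lq mul1r => /eqP; rewrite addrC addr_eq0 => /eqP eqn.
have dvd : b %| a ^+ n.
  case: n {lq} sq eqn => [|n] sq eqn.
    by move/eqP: eqn; rewrite big_ord0 oppr0 expr0 oner_eq0.
  apply/dvdpP; exists (- \sum_(i < n.+1) q`_i * a ^+ i * b ^+ (n - i)).
  apply: tofrac_inj; rewrite rmorphXn.
  apply: (mulIf (expf_neq0 n.+1 (invr_neq0 fb0))); rewrite -exprMn eqn.
  rewrite rmorphM rmorphN /= 2!mulNr; congr (- _).
  rewrite rmorph_sum /= !mulr_suml; apply: eq_bigr => i _.
  have le_in : (i <= n)%N by rewrite -ltnS.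
  have yE := expr_cancel fb0 le_in.
  rewrite coef_map !tofracM !tofracXn exprMn -yE !mulrA; congr (_ * _ * _ * _).
have : b %| 1.
  by rewrite -(Gauss_dvdpr _ (coprimep_expr n cab)) mulr1.
rewrite dvdp1 => /size_poly1P[c c0 Dc].
exists (c^-1 *: a); apply: (canLR (mulfK fb0)); rewrite -rmorphM Dc.
by rewrite mulrC mul_polyC scalerA divff // scale1r.
Qed.

Section Parity.
Variables (W : fieldType) (i0 : {rmorphism k -> W}) (tau : W).
Local Notation mult a := (mup tau (map_poly i0 a)).

Definition specialize : {rmorphism {poly k} -> W} :=
  horner_eval tau \o map_poly i0.

(** The parity of the order of vanishing of z at tau, with true for odd. As a
relation it involves no choice of a fraction representing z. *)
Definition order_parity z (e : bool) : Prop := exists a b,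
  [/\ a != 0, b != 0, z = tofrac a / tofrac b & odd (mult a + mult b) = e].

Lemma multM a b : a != 0 -> b != 0 -> mult (a * b) = (mult a + mult b)%N.
Proof. by move=> a0 b0; rewrite rmorphM mupM ?map_poly_eq0. Qed.

Lemma mult_regular a : specialize a != 0 -> mult a = 0%N.
Proof. exact: mupNroot. Qed.

Lemma mult_simple a : specialize a = 0 -> specialize a^`() != 0 -> mult a = 1%N.
Proof.
move=> a0 a1; have nz : map_poly i0 a != 0.
  rewrite map_poly_eq0; apply: contraNneq a1 => ->.
  by rewrite deriv0 rmorph0.
have : root (map_poly i0 a) tau by apply/rootP.
rewrite -dvdp_XsubCl => /dvdpP[q Dq].
have q1 : ~~ root q tau.
  apply: contraNN a1 => /rootP q0; rewrite /specialize /= /horner_eval -deriv_map Dq.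
  by rewrite derivM derivXsubC mulr1 !hornerE q0 subrr mulr0 addr0.
by rewrite Dq mupMr // (@mup_XsubCX _ 1) eqxx.
Qed.

Lemma order_parity_uniq z e e' : order_parity z e -> order_parity z e' -> e = e'.
Proof.
case=> a [b [a0 b0 -> <-]] [a' [b' [a'0 b'0 eqz <-]]].
have /(congr1 (fun q => mult q)) : a * b' = a' * b.
  apply: tofrac_inj; rewrite !rmorphM; apply/eqP.
  by rewrite -eqr_div ?tofrac_eq0 // eqz.
rewrite !multM // => eqm.
rewrite !oddD; have := congr1 odd eqm; rewrite !oddD.
by do 4!case: (odd _).
Qed.

Lemma order_parityM z z' e e' :
  order_parity z e -> order_parity z' e' -> order_parity (z * z') (e (+) e').
Proof.
case=> a [b [a0 b0 -> <-]] [a' [b' [a'0 b'0 -> <-]]].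
exists (a * a'), (b * b'); rewrite !mulf_neq0 ?multM // -oddD addnACA.
by split=> //; rewrite !rmorphM mulf_div.
Qed.

Lemma order_parity_regular a : specialize a != 0 -> order_parity (tofrac a) false.
Proof.
move=> sa; have a0 : a != 0 by apply: contraNneq sa => ->; rewrite rmorph0.
exists a, 1; rewrite oner_neq0 a0 rmorph1 divr1 !mult_regular //.
by rewrite rmorph1 oner_neq0.
Qed.

Lemma order_parity1 : order_parity 1 false.
Proof.
rewrite -(rmorph1 (@tofrac {poly k})); apply: order_parity_regular.
by rewrite rmorph1 oner_neq0.
Qed.

Lemma order_parityX z e n : order_parity z e -> order_parity (z ^+ n) (odd n && e).
Proof.
move=> oz; elim: n => [|n IHn]; first exact: order_parity1.
have := order_parityM oz IHn; rewrite -exprS.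
by congr order_parity; rewrite /=; case: (odd n); case: e {oz IHn}.
Qed.

Lemma order_parity_sqr z : z != 0 -> order_parity (z ^+ 2) false.
Proof.
move=> z0; have [a [b [b0 Dz]]] := fraction_quotient z.
have a0 : a != 0 by apply: contraNneq z0 => a0; rewrite Dz a0 rmorph0 mul0r.
by apply: (@order_parityX z (odd (mult a + mult b)) 2); exists a, b.
Qed.

Lemma order_parity_neq0 z e : order_parity z e -> z != 0.
Proof. by case=> a [b [a0 b0 -> _]]; rewrite mulf_neq0 ?invr_eq0 ?tofrac_eq0. Qed.

(** Squares have even order, and functions that are regular and non-zero at tau
have order zero. *)
Lemma odd_order_nonsquare (D : K) : order_parity D true ->
  forall a z, specialize a != 0 -> z ^+ 2 != tofrac a * D.
Proof.
move=> oD a z sa; apply: contraTneq isT => eqz.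
have oaD := order_parityM (order_parity_regular sa) oD.
have z0 : z != 0.
  by apply: contraNneq (order_parity_neq0 oaD) => z0; rewrite -eqz z0 expr0n.
by have := order_parity_uniq oaD; rewrite -eqz => /(_ _ (order_parity_sqr z0)).
Qed.
End Parity.
End RationalFunctions.

(** * Iteration with cleared denominators *)

Section ClearedIteration.
Variable p : nat.

(** The pair of a numerator and a denominator of the iterates at x of the map
y |-> y^p + (B / D) y^(p-1) + t, computed without division so that it makes sense
over any commutative ring and commutes with every ring morphism. *)
Definition cleared (R : comNzRingType) (D B t x : R) n : R * R :=
  iter n (fun UV => (UV.1 ^+ p.-1 * (UV.1 * D + UV.2 * B) + t * (UV.2 ^+ p * D),
                     UV.2 ^+ p * D)) (x, 1).

Definition phi_den (R : comNzRingType) (t : R) : R := p%:R * t ^+ p.-1 + p%:R - 1.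
Definition phi_num (R : comNzRingType) (t : R) : R := - p%:R * t ^+ p - p%:R * t.
Definition iter_num (R : comNzRingType) (t x : R) n : R :=
  (cleared (phi_den t) (phi_num t) t x n).1.
Definition iter_den (R : comNzRingType) (t : R) n : R :=
  (cleared (phi_den t) (phi_num t) t 0 n).2.

Lemma cleared_den (R : comNzRingType) (D B B' t t' x x' : R) n :
  (cleared D B t x n).2 = (cleared D B' t' x' n).2.
Proof. by elim: n => //= n ->. Qed.

Lemma cleared_morph (R S : comNzRingType) (f : {rmorphism R -> S}) (D B t x : R) n :
  cleared (f D) (f B) (f t) (f x) n
  = (f (cleared D B t x n).1, f (cleared D B t x n).2).
Proof.
elim: n => [|n IHn] /=; first by rewrite rmorph1.
by rewrite -/(cleared _ _ _ _ _) IHn /= !(rmorphD, rmorphM, rmorphXn).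
Qed.

Lemma phi_den_morph (R S : comNzRingType) (f : {rmorphism R -> S}) t :
  f (phi_den t) = phi_den (f t).
Proof. by rewrite rmorphB rmorph1 rmorphD rmorphM rmorphXn !rmorph_nat. Qed.

Lemma phi_num_morph (R S : comNzRingType) (f : {rmorphism R -> S}) t :
  f (phi_num t) = phi_num (f t).
Proof. by rewrite rmorphB !rmorphM rmorphN rmorphXn !rmorph_nat. Qed.

Lemma iter_num_morph (R S : comNzRingType) (f : {rmorphism R -> S}) t x n :
  f (iter_num t x n) = iter_num (f t) (f x) n.
Proof. by rewrite /iter_num -phi_den_morph -phi_num_morph cleared_morph. Qed.

Lemma iter_den_morph (R S : comNzRingType) (f : {rmorphism R -> S}) t n :
  f (iter_den t n) = iter_den (f t) n.
Proof.
by rewrite /iter_den -phi_den_morph -phi_num_morph -(rmorph0 f) cleared_morph.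
Qed.

Lemma iter_denS (R : comNzRingType) (t : R) n :
  iter_den t n.+1 = iter_den t n ^+ p * phi_den t.
Proof. by []. Qed.

Lemma iter_den_neq0 (R : idomainType) (t : R) n : phi_den t != 0 -> iter_den t n != 0.
Proof.
move=> D0; elim: n => [|n IHn]; first exact: oner_neq0.
by rewrite iter_denS mulf_neq0 ?expf_neq0.
Qed.

Hypothesis p_gt0 : (0 < p)%N.

Lemma clearedE (R : comNzRingType) (D A B t x : R) n : D * A = B ->
  (cleared D B t x n).1 =
  (cleared D B t x n).2 * iter n (fun y => y ^+ p + A * y ^+ p.-1 + t) x.
Proof.
move=> DA; elim: n => [|n IHn] /=; first by rewrite mul1r.
rewrite -/(cleared _ _ _ _ _) IHn; set y := iter _ _ _; set V := _.2.
rewrite -DA !mulrDr -[in y ^+ p](prednK p_gt0) -[in V ^+ p](prednK p_gt0).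
rewrite !exprMn !exprSr; set a := V ^+ _; set b := y ^+ _.
ring.
Qed.

Lemma iter_numE (R : comNzRingType) (A t x : R) n : phi_den t * A = phi_num t ->
  iter_num t x n = iter_den t n * iter n (fun y => y ^+ p + A * y ^+ p.-1 + t) x.
Proof.
move=> DA; rewrite /iter_num (clearedE _ _ _ DA) /iter_den; congr (_ * _).
exact: cleared_den.
Qed.

(** Since t divides the coefficient of y^(p-1) and p >= 3, applying the map to a
multiple of t adds to t only a multiple of t^2. *)
Lemma iter_num_simple_zero (R : comNzRingType) (t : R) n : (2 < p)%N ->
  exists q, iter_num t 0 n.+1 = t * (iter_den t n.+1 + t * q).
Proof.
move=> p_gt2.
have DS u v d b : exists q,
   (t * u) ^+ p.-1 * ((t * u) * d + v * (t * b)) + t * (v ^+ p * d)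
   = t * (v ^+ p * d + t * q).
  case: p p_gt2 => [|[|[|p']]] // _ /=.
  exists ((t * u) ^+ p' * u ^+ 2 * ((t * u) * d + v * (t * b))).
  rewrite !exprS; set a := (t * u) ^+ p'; set w := v ^+ p'; ring.
have [b Db] : exists b, phi_num t = t * b.
  exists (- p%:R * t ^+ p.-1 - p%:R); rewrite mulrBr mulrCA -exprS prednK //.
  by rewrite /phi_num [t * _]mulrC.
have [u Du] : exists u, iter_num t 0 n = t * u.
  elim: n => [|n [u Du]]; first by exists 0; rewrite mulr0.
  rewrite /iter_num /= -/(cleared _ _ _ _ _) -/(iter_num _ _ _) Du Db.
  by have [q ->] := DS u (cleared (phi_den t) (t * b) t 0 n).2 (phi_den t) b; eexists.
rewrite /iter_num /= -/(cleared _ _ _ _ _) -/(iter_num _ _ _) Du.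
have [q] := DS u (cleared (phi_den t) (phi_num t) t 0 n).2 (phi_den t) b.
by rewrite -Db; exists q.
Qed.
End ClearedIteration.

(** * A primitive simple zero of the critical orbit *)

(** The cofactor of gcd(W, X) in W is coprime to that gcd, hence to X, and it
divides a power of X: it is constant. *)
Lemma dvdp_exp_separable (F : fieldType) (W X : {poly F}) s :
  separable_poly W -> W %| X ^+ s -> W %| X.
Proof.
move=> sepW WXs; pose d := gcdp W X; pose e := W %/ d.
have De : W = e * d by rewrite divpK ?dvdp_gcdl.
have ed : coprimep e d by apply: (separable_coprime sepW); rewrite -De.
have eX : coprimep e X.
  rewrite /coprimep; have : gcdp e X %| 1; last by rewrite dvdp1.
  have gd : gcdp e X %| d.
    by rewrite dvdp_gcd dvdp_gcdr andbT (dvdp_trans (dvdp_gcdl _ _)) // De dvdp_mulr.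
  have /eqp_dvdr <- : gcdp e d %= 1 by rewrite -size_poly_eq1.
  by rewrite dvdp_gcd dvdp_gcdl.
have : e %| 1.
  rewrite -(Gauss_dvdpr _ (coprimep_expr s eX)) mulr1.
  by apply: dvdp_trans WXs; rewrite De dvdp_mulr.
rewrite dvdp1 => e1; rewrite De -(mul1r X); apply: dvdp_mul; last exact: dvdp_gcdr.
by rewrite dvdp1.
Qed.

(** Divide W by its common factors with Y until nothing is left or the remaining
factor is coprime to Y. *)
Lemma coprime_factor_or_power (R : idomainType) (W Y : {poly R}) : W != 0 ->
  (exists s, W %| Y ^+ s) \/
  (exists J, [/\ J %| W, (1 < size J)%N & coprimep J Y]).
Proof.
have [n] := ubnP (size W); elim: n W => // n IHn W le_n W0.
have [cWY|ncWY] := boolP (coprimep W Y).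
  have [W1|] := leqP (size W) 1; last by right; exists W.
  left; exists 0; rewrite expr0 dvdp1 eqn_leq W1 lt0n size_poly_eq0 //.
pose g := gcdp W Y.
have g1 : (1 < size g)%N.
  move: ncWY; rewrite /coprimep -/g; have : size g != 0%N.
    by rewrite size_poly_eq0 gcdp_eq0 negb_and W0.
  by case: (size g) => [|[]].
have /Pdiv.Idomain.dvdpP[[c q] /= c0 Dq] := dvdp_gcdl W Y; rewrite -/g in Dq.
have cW0 : c *: W != 0 by rewrite scale_poly_eq0 negb_or c0.
have /norP[q0 g0] : ~~ ((q == 0) || (g == 0)) by rewrite -mulf_eq0 -Dq.
have szq : (size q < size W)%N.
  rewrite -(size_scale W c0) Dq size_mul // -[size g]prednK ?(ltnW g1) //.
  by rewrite addnS /= -[X in (X < _)%N]addn0 ltn_add2l -ltnS prednK // ltnW.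
case: (IHn q) => // [|[s qY]|[J [Jq J1 JY]]]; first exact: leq_trans szq le_n.
  left; exists s.+1; rewrite -(dvdpZl _ _ c0) Dq exprSr.
  by apply: dvdp_mul => //; apply: dvdp_gcdr.
right; exists J; split=> //; rewrite -(dvdpZr _ _ c0) Dq.
exact: dvdp_mulr.
Qed.

Section Existence.
Variables (p n : nat).
Hypotheses (p_prime : prime p) (p_ge3 : (3 <= p)%N).

Section Modp.
Local Notation T := ('X : {poly 'F_p}).
Let p_gt0 : (0 < p)%N := prime_gt0 p_prime.
Local Definition orbit_modp m := iter m (fun y => y ^+ p + 0 * y ^+ p.-1 + T) 0.

Let p0 : p%:R = 0 :> {poly 'F_p}.
Proof. by rewrite -polyC_natr (pcharf0 (pchar_Fp p_prime)). Qed.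

Lemma phi_den_modp : phi_den p T = -1.
Proof. by rewrite /phi_den p0 mul0r !add0r. Qed.

(** Modulo p the numerator phi_num vanishes and the denominator phi_den is -1, so
that the map becomes y^p + t. *)
Lemma iter_num_modp m : exists b : bool, iter_num p T 0 m = (-1) ^+ b * orbit_modp m.
Proof.
have D0 : phi_den p T * 0 = phi_num p T by rewrite /phi_num p0 oppr0 !mul0r subr0 mulr0.
rewrite (iter_numE p_gt0 _ _ D0) -/(orbit_modp m).
suff [b ->] : exists b : bool, iter_den p T m = (-1) ^+ b by exists b.
elim: m => [|m [b Db]]; first by exists false.
exists ((odd p && b) (+) true).
rewrite iter_denS Db phi_den_modp signr_addb; congr (_ * _).
by rewrite -exprM -[LHS]signr_odd oddM oddb andbC.
Qed.

Lemma size_orbit_modp m : size (orbit_modp m.+1) = (p ^ m).+1.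
Proof.
elim: m => [|m IHm].
  by rewrite /orbit_modp /= expr0n gtn_eqF // mul0r !add0r size_polyX.
have szp : size (orbit_modp m.+1 ^+ p) = (p ^ m.+1).+1.
  rewrite -[LHS]prednK ?size_exp ?IHm ?expnSr //.
  by rewrite lt0n size_poly_eq0 expf_neq0 // -size_poly_eq0 IHm.
rewrite {1}/orbit_modp iterS -/(orbit_modp m.+1) mul0r addr0.
rewrite size_polyDl szp // size_polyX ltnS.
by rewrite expnS (leq_trans _ (leq_pmulr _ _)) ?expn_gt0 ?p_gt0 // ltnW.
Qed.

Lemma deriv_orbit_modp m : (orbit_modp m.+1)^`() = 1.
Proof.
rewrite {1}/orbit_modp iterS -/(orbit_modp m) mul0r addr0 derivD derivX deriv_exp.
by rewrite -mulr_natl p0 mul0r add0r.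
Qed.

Lemma size_prod_orbit_modp m : (size (\prod_(i < m) orbit_modp i.+1)%R <= p ^ m)%N.
Proof.
elim: m => [|m IHm]; first by rewrite big_ord0 size_poly1.
rewrite big_ord_recr (leq_trans (size_polyMleq _ _)) // size_orbit_modp addnS /=.
apply: leq_trans (_ : 2 * p ^ m <= _)%N; first by rewrite mul2n -addnn leq_add2r.
by rewrite expnS leq_mul2r prime_gt1 ?orbT.
Qed.

Lemma prod_orbit_modp_neq0 m : \prod_(i < m) orbit_modp i.+1 != 0.
Proof. by apply/prodf_neq0 => i _; rewrite -size_poly_eq0 size_orbit_modp. Qed.
End Modp.

(** Otherwise the integral polynomial U (n + 1) would divide a power of the product
of its derivative, the earlier U i and the denominator. By Gauss's lemma this
persists modulo p for its primitive part; there the derivative and the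
denominator are units and U (n + 1) is separable, so it would divide the product
of the earlier ones, whose degree is smaller. *)
Lemma primitive_simple_zero (W : closedFieldType) (chW : [pchar W] =i pred0) :
  exists tau : W, [/\ phi_den p tau != 0, iter_num p tau 0 n.+1 = 0,
     ((iter_num p 'X 0 n.+1 : {poly W})^`()).[tau] != 0
   & forall i, (0 < i <= n)%N -> iter_num p tau 0 i != 0].
Proof.
pose U i : {poly int} := iter_num p 'X 0 i.
pose X := phi_den p 'X * \prod_(i < n) U i.+1 : {poly int}.
(* A zero of U (n + 1) that is not a zero of Y is simple and primitive. *)
pose Y := (U n.+1)^`() * X.
pose red : {rmorphism {poly int} -> {poly 'F_p}} := map_poly intr.
have redU i : red (U i) = iter_num p 'X 0 i.
  by rewrite iter_num_morph rmorph0 /= map_polyX.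
have redU0 i : red (U i.+1) != 0.
  have [b] := iter_num_modp i.+1; rewrite redU => ->.
  by rewrite mulf_neq0 ?signr_eq0 // -size_poly_eq0 size_orbit_modp.
have U0 : U n.+1 != 0.
  by apply: contraNneq (redU0 n) => ->; rewrite rmorph0.
have [b Db] := iter_num_modp n.+1; rewrite -redU in Db.
have dU : (red (U n.+1))^`() = (-1) ^+ b.
  rewrite Db; case: b {Db};
    by rewrite ?expr1 ?expr0 ?mulN1r ?mul1r ?derivN deriv_orbit_modp.
have rdU : red ((U n.+1)^`()) = (-1) ^+ b by rewrite -dU /= deriv_map.
have redX : exists b : bool, red X = (-1) ^+ b * \prod_(i < n) orbit_modp i.+1.
  have [c Dc] : exists c : bool,
      red (\prod_(i < n) U i.+1) = (-1) ^+ c * \prod_(i < n) orbit_modp i.+1.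
    rewrite rmorph_prod; apply: prod_up_to_sign => i.
    by rewrite redU; apply: iter_num_modp.
  exists (~~ c); rewrite rmorphM Dc phi_den_morph /= map_polyX phi_den_modp.
  by rewrite signrN mulNr mulN1r.
case: (coprime_factor_or_power Y U0) => [[s]|[J [JU J1 JY]]].
  case/dvdpP_int => r Ys; exfalso.
  have WX : red (U n.+1) %| red X.
    apply: (dvdp_exp_separable (s := s)).
      rewrite separable_poly.unlock dU; case: (b); last exact: coprimep1.
      by rewrite expr1 -[-1]scaleN1r coprimepZr ?oppr_eq0 ?oner_eq0 // coprimep1.
    have -> : red X ^+ s = ((-1) ^+ b) ^+ s * red (Y ^+ s).
      rewrite rmorphXn -exprMn; congr (_ ^+ _).
      have -> : red Y = (-1) ^+ b * red X.
        transitivity (red ((U n.+1)^`()) * red X); first exact: (rmorphM red).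
        by congr (_ * _); exact: rdU.
      by rewrite signrMK.
    apply: dvdp_mull; rewrite Ys rmorphM; apply: dvdp_mulr.
    have Dz : red (U n.+1) = (zcontents (U n.+1))%:~R *: red (zprimitive (U n.+1)).
      by rewrite {1}[U n.+1]zpolyEprim /red /= map_polyZ.
    (* The content is prime to p because the reduction is not zero. *)
    have z0 : (zcontents (U n.+1))%:~R != 0 :> 'F_p.
      by apply: contraNneq (redU0 n) => z0; rewrite Dz z0 scale0r.
    by rewrite Dz dvdpZl.
  have [c Dc] := redX.
  have X0 : red X != 0 by rewrite Dc mulf_neq0 ?signr_eq0 // prod_orbit_modp_neq0.
  have := dvdp_leq X0 WX; rewrite Db Dc !size_Msign size_orbit_modp.
  by move/leq_trans/(_ (size_prod_orbit_modp n)); rewrite ltnn.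
pose inc : {rmorphism {poly int} -> {poly W}} := map_poly intr.
have int0 (a : int) : a%:~R = 0 :> W -> a = 0.
  have /pcharf0P nat0 := chW.
  case: a => m /eqP am.
    by have := nat0 m; rewrite [_ == _]am => /esym/eqP ->.
  move: am; rewrite NegzE rmorphN oppr_eq0 => am.
  by have := nat0 m.+1; rewrite [_ == _]am.
have int_inj : injective (intr : int -> W).
  move=> a c /eqP; rewrite -subr_eq0 -rmorphB => /eqP/int0/eqP.
  by rewrite subr_eq0 => /eqP.
have inc_inj : injective inc.
  apply: map_inj_poly; last exact: rmorph0.
  exact: int_inj.
have [tau tauJ] : exists tau, root (inc J) tau.
  apply/closed_rootP; rewrite size_map_inj_poly ?rmorph0 //.
  by rewrite neq_ltn J1 orbT.
pose ev : {rmorphism {poly int} -> W} := horner_eval tau \o inc.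
have evX : ev 'X = tau by rewrite /ev /= /horner_eval map_polyX hornerX.
have evU i : ev (U i) = iter_num p tau 0 i by rewrite iter_num_morph rmorph0 evX.
have evJ : ev J = 0 by apply/rootP.
have evY : ev Y != 0.
  have [[u v] /= uv] := Bezoutp J Y.
  have : size (u * J + v * Y) == 1%N by rewrite (eqp_size uv).
  case/size_poly1P => c c0 Duv.
  have : ev (u * J + v * Y) != 0.
    rewrite Duv /ev /= /horner_eval map_polyC hornerC /=.
    by apply: contraNneq c0 => /int0 ->.
  have -> : ev (u * J + v * Y) = ev u * ev J + ev v * ev Y.
    by rewrite rmorphD !rmorphM.
  by rewrite evJ mulr0 add0r mulf_eq0 negb_or => /andP[].
have evU0 : ev (U n.+1) = 0.
  have /Pdiv.Idomain.dvdpP[[c q] /= c0 Dq] := JU.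
  have : ev (c%:P) * ev (U n.+1) = ev q * ev J.
    by rewrite -!rmorphM mul_polyC Dq.
  rewrite evJ mulr0 => /eqP; rewrite mulf_eq0 => /orP[|/eqP//].
  rewrite {1}/ev /= /horner_eval map_polyC hornerC /= => /eqP/int0 c00.
  by rewrite c00 eqxx in c0.
have eY : ev Y = ev ((U n.+1)^`()) * (phi_den p tau * \prod_(i < n) ev (U i.+1)).
  by rewrite -evX -phi_den_morph -rmorph_prod -!rmorphM.
move: evY; rewrite eY !mulf_eq0 !negb_or => /and3P[dU0 D0 /prodf_neq0 prod0].
exists tau; split=> //; first by rewrite -evU.
  move: dU0; rewrite {1}/ev /= /horner_eval -deriv_map.
  by rewrite [map_poly _ _](iter_num_morph p inc) rmorph0 /= map_polyX.
by case=> // i /= lt_in; have := prod0 (Ordinal lt_in) isT; rewrite evU.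
Qed.
End Existence.

(** * Iterates, critical points and multiple roots *)

Lemma iter_poly_horner (R : comNzRingType) (phi : {poly R}) n x :
  (iter_poly phi n).[x] = iter n (horner phi) x.
Proof. by elim: n => [|n IHn] /=; rewrite ?hornerX // horner_comp -IHn. Qed.

Lemma iter_poly_add (R : comNzRingType) (phi : {poly R}) m n :
  iter_poly phi (m + n) = iter_poly phi m \Po iter_poly phi n.
Proof.
elim: m => [|m IHm]; first by rewrite add0n comp_polyX.
by rewrite addSn /iter_poly !iterS -/(iter_poly _ _) IHm comp_polyA.
Qed.

Lemma map_iter_poly (R S : nzRingType) (f : {rmorphism R -> S}) phi n :
  map_poly f (iter_poly phi n) = iter_poly (map_poly f phi) n.
Proof.
elim: n => [|n IHn]; first exact: map_polyX.
by rewrite /iter_poly !iterS -/(iter_poly _ _) map_comp_poly IHn.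
Qed.

Lemma iter_horner_morph (R S : comNzRingType) (f : {rmorphism R -> S}) phi n x :
  f (iter n (horner phi) x) = iter n (horner (map_poly f phi)) (f x).
Proof. by rewrite -!iter_poly_horner -map_iter_poly horner_map. Qed.

Lemma deriv_iter_poly (R : comNzRingType) (phi : {poly R}) n x :
  (iter_poly phi n)^`().[x] = \prod_(j < n) phi^`().[iter j (horner phi) x].
Proof.
elim: n => [|n IHn]; first by rewrite big_ord0 /iter_poly /= derivX hornerC.
rewrite big_ord_recr -IHn /iter_poly iterS -/(iter_poly _ _) deriv_comp hornerM.
by rewrite mulrC horner_comp iter_poly_horner.
Qed.

Lemma iter_poly_monic_size (R : idomainType) (phi : {poly R}) d n :
  phi \is monic -> size phi = d.+2 ->
  iter_poly phi n \is monic /\ size (iter_poly phi n) = (d.+1 ^ n).+1.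
Proof.
move=> phi_mon szphi; elim: n => [|n [mon sz]]; first by rewrite monicX size_polyX.
have gt1 : (1 < size (iter_poly phi n))%N by rewrite sz ltnS expn_gt0.
rewrite /iter_poly iterS -/(iter_poly _ _); split.
  by rewrite monicE lead_coef_comp // (monicP mon) (monicP phi_mon) expr1n mulr1.
have := size_comp_poly phi (iter_poly phi n); rewrite szphi sz /= -expnS => <-.
by rewrite prednK // lt0n size_poly_eq0 comp_poly_eq0 // monic_neq0.
Qed.

Lemma deriv_prod_XsubC (R : comNzRingType) (I : finType) (x : I -> R) i :
  (\prod_i ('X - (x i)%:P))^`().[x i] = \prod_(i' | i' != i) (x i - x i').
Proof.
rewrite (bigD1 i) //= derivM derivXsubC mul1r !hornerE subrr mul0r addr0.
by rewrite horner_prod; apply: eq_bigr => i' _; rewrite hornerXsubC.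
Qed.

(** The roots are indexed by an ordinal so that permutations act on the indices. *)
Lemma closed_field_prod_XsubC (W : closedFieldType) (P : {poly W}) M :
  P \is monic -> size P = M.+1 ->
  exists w : 'I_M -> W, P = \prod_i ('X - (w i)%:P).
Proof.
move=> mon sz; have [r] := closed_field_poly_normal P.
rewrite (monicP mon) scale1r => Pr.
have szr : size r = M by move: sz; rewrite Pr size_prod_XsubC => -[].
exists (fun i => r`_i); rewrite {1}Pr (big_nth 0) big_mkord szr.
by apply: eq_bigr.
Qed.

Lemma mup_simple_deriv (F : fieldType) (P Q : {poly F}) c : 2%:R != 0 :> F ->
  root P c -> P^`() = ('X - c%:P) * Q -> ~~ root Q c -> mup c P = 2.
Proof.
move=> two0 /factor_theorem[P1 DP] dP Qc.
have : root P1 c.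
  have : P^`().[c] == 0 by rewrite dP !hornerE subrr mul0r.
  by rewrite DP derivM derivXsubC !hornerE subrr mulr0 add0r.
case/factor_theorem => P2 DP1; rewrite DP1 -mulrA -expr2 in DP.
have DQ : Q = P2 *+ 2 + ('X - c%:P) * P2^`().
  have Xc0 : 'X - c%:P != 0 by rewrite polyXsubC_eq0.
  apply: (mulfI Xc0); rewrite -dP DP derivM deriv_exp derivXsubC.
  rewrite mul1r /= expr1; ring.
have P2c : ~~ root P2 c.
  apply: contraNN Qc => /rootP P2c; apply/rootP.
  by rewrite DQ !hornerE P2c subrr mul0r !addr0.
by rewrite DP mupMr // mup_XsubCX eqxx.
Qed.

(** This is the symmetry, up to sign, of the resultant of h(q) and q - w: at a root
of q - w the polynomial h(q) takes the value h(w). *)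
Lemma prod_comp_roots (W : closedFieldType) (h q : {poly W}) M (x : 'I_M -> W) w :
    q \is monic -> (1 < size q)%N ->
    h \Po q = \prod_i ('X - (x i)%:P) ->
  exists b : bool, \prod_i (q.[x i] - w) = (-1) ^+ b * h.[w] ^+ (size q).-1.
Proof.
move=> q_mon q1 Dhq; set d := (size q).-1.
have sz : size (q - w%:P) = d.+1.
  rewrite size_polyDl; first by rewrite /d prednK // ltnW.
  by rewrite size_polyN (leq_ltn_trans (size_polyC_leq1 _)).
have mon : q - w%:P \is monic.
  rewrite monicE lead_coefDl -?monicE //.
  by rewrite size_polyN (leq_ltn_trans (size_polyC_leq1 _)).
have [g Dg] := closed_field_prod_XsubC mon sz.
have hw l : h.[w] = \prod_i (g l - x i).
  have qg : q.[g l] = w.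
    apply/eqP; rewrite -subr_eq0 -[w in _ - w](hornerC w (g l)) -hornerN -hornerD Dg.
    exact: root_prod_XsubC_mem.
  rewrite -{1}qg -horner_comp Dhq horner_prod.
  by apply: eq_bigr => i _; rewrite hornerXsubC.
have Dq i : q.[x i] - w = \prod_l (x i - g l).
  rewrite -[w in LHS](hornerC w (x i)) -hornerN -hornerD Dg horner_prod.
  by apply: eq_bigr => l _; rewrite hornerXsubC.
under eq_bigr => i _ do rewrite Dq.
rewrite exchange_big /=.
have -> : h.[w] ^+ d = \prod_(l < d) \prod_i (g l - x i).
  by under eq_bigr => l _ do rewrite -hw; rewrite prodr_const card_ord.
apply: prod_up_to_sign => l; apply: prod_up_to_sign => i.
by exists true; rewrite expr1 mulN1r opprB.
Qed.

Section Family.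
Variable p : nat.
Hypotheses (p_prime : prime p) (p_ge3 : (3 <= p)%N).

(** The polynomial of the theorem with its parameter replaced by an element of any
field, so that it can be specialized. *)
Definition phi_at (F : fieldType) (t : F) : {poly F} :=
  'X^p + (phi_num p t / phi_den p t)%:P * 'X^(p.-1) + t%:P.

Definition orbit0 (F : fieldType) (t : F) m : F := iter m (horner (phi_at t)) 0.

Lemma map_phi_at (F F' : fieldType) (f : {rmorphism F -> F'}) t :
  map_poly f (phi_at t) = phi_at (f t).
Proof.
rewrite !rmorphD rmorphM /= !map_polyXn !map_polyC /= fmorph_div.
by rewrite phi_num_morph phi_den_morph.
Qed.

Lemma orbit0_morph (F F' : fieldType) (f : {rmorphism F -> F'}) t m :
  f (orbit0 t m) = orbit0 (f t) m.
Proof. by rewrite /orbit0 iter_horner_morph map_phi_at rmorph0. Qed.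

Variable F : fieldType.
Hypothesis ch0 : [pchar F] =i pred0.
Variable t : F.
Hypothesis D0 : phi_den p t != 0.
Local Notation phi := (phi_at t).
Local Notation c := (orbit0 t 2).

Let p_gt0 : (0 < p)%N := prime_gt0 p_prime.

Let natF0 n : (n%:R == 0 :> F) = (n == 0)%N.
Proof. by move/pcharf0P: ch0. Qed.

Lemma phi_at_horner y : phi.[y] = y ^+ p + (phi_num p t / phi_den p t) * y ^+ p.-1 + t.
Proof. by rewrite /phi_at !hornerE. Qed.

Lemma orbit0_iter m n : iter n (horner phi) (orbit0 t m) = orbit0 t (n + m).
Proof. by rewrite /orbit0 -iterD. Qed.

Lemma orbit0_num m : orbit0 t m = iter_num p t 0 m / iter_den p t m.
Proof.
have DA : phi_den p t * (phi_num p t / phi_den p t) = phi_num p t.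
  by rewrite mulrC divfK.
rewrite (iter_numE p_gt0 _ _ DA) mulrC mulKf ?iter_den_neq0 //.
by apply: eq_iter => y; rewrite phi_at_horner.
Qed.

Lemma phi_at_size : size phi = p.-1.+2.
Proof.
rewrite prednK // /phi_at -addrA size_polyDl size_polyXn //.
rewrite ltnS (leq_trans (size_polyD _ _)) // geq_max.
rewrite (leq_trans (size_polyC_leq1 _)) ?andbT //.
by rewrite mul_polyC (leq_trans (size_scale_leq _ _)) // size_polyXn prednK.
Qed.

Lemma phi_at_monic : phi \is monic.
Proof.
rewrite monicE /phi_at -addrA lead_coefDl ?lead_coefXn // size_polyXn.
rewrite ltnS (leq_trans (size_polyD _ _)) // geq_max.
rewrite (leq_trans (size_polyC_leq1 _)) ?andbT //.
by rewrite mul_polyC (leq_trans (size_scale_leq _ _)) // size_polyXn prednK.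
Qed.

Lemma iter_phi_at_monic n : iter_poly phi n \is monic.
Proof. by case: (iter_poly_monic_size n phi_at_monic phi_at_size). Qed.

Lemma iter_phi_at_size n : size (iter_poly phi n) = (p ^ n).+1.
Proof.
by case: (iter_poly_monic_size n phi_at_monic phi_at_size) => _; rewrite prednK.
Qed.

(** This identity is what the coefficient of x^(p-1) is designed for: the second
iterate of 0 is the non-zero critical point of phi. *)
Lemma critical_point : p%:R * c = - (p.-1%:R * (phi_num p t / phi_den p t)).
Proof.
have -> : orbit0 t 2 = t ^+ p + (phi_num p t / phi_den p t) * t ^+ p.-1 + t.
  have p1 : (0 < p.-1)%N by rewrite -ltnS prednK // ltnW.
  rewrite /orbit0 /= !phi_at_horner !expr0n !gtn_eqF // mulr0 !add0r.
  by [].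
apply: (mulfI D0); rewrite !mulrDr.
have DA : phi_den p t * (phi_num p t / phi_den p t) = phi_num p t.
  by rewrite mulrC divfK.
rewrite mulrN [RHS](_ : _ = - (p.-1%:R * phi_num p t)); last first.
  by rewrite mulrCA DA.
rewrite [X in _ + X + _](_ : _ = p%:R * (phi_num p t * t ^+ p.-1)); last first.
  by rewrite mulrCA !mulrA -[_ * _ * phi_num _ _ / _]mulrA -DA; field.
have -> : p.-1%:R = p%:R - 1 :> F by rewrite -{2}(prednK p_gt0) -natr1 addrK.
rewrite /phi_num /phi_den -[in t ^+ p](prednK p_gt0) exprS.
by set u := t ^+ p.-1; ring.
Qed.

Lemma deriv_phi_at : phi^`() = (p%:R *: 'X^(p.-2)) * ('X - c%:P).
Proof.
rewrite mulrBr -mul_polyC [_ * c%:P]mulrAC -polyCM critical_point.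
rewrite /phi_at !derivD derivC addr0 derivM derivC mul0r add0r !derivXn.
have -> : 'X^(p.-1) = 'X^(p.-2) * 'X :> {poly F}.
  by rewrite -exprSr prednK // -ltnS prednK // ltnW.
rewrite polyCN polyCM !polyC_natr; set u := 'X^(p.-2).
have -> : u * 'X *+ p = p%:R * (u * 'X) by rewrite mulr_natl.
have -> : u *+ p.-1 = p.-1%:R * u by rewrite mulr_natl.
ring.
Qed.

Lemma deriv_phi_at_horner y : phi^`().[y] = p%:R * y ^+ p.-2 * (y - c).
Proof. by rewrite deriv_phi_at !hornerE. Qed.

Lemma deriv_phi_at_eq0 y : phi^`().[y] = 0 -> y = 0 \/ y = c.
Proof.
rewrite deriv_phi_at_horner => /eqP; rewrite !mulf_eq0 natF0 gtn_eqF //= subr_eq0.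
by case/orP=> [|/eqP]; [rewrite expf_eq0 => /andP[_ /eqP] | ]; [left | right].
Qed.

(** By the chain rule, a multiple root of an iterate meets a critical point on its
way to 0; then the orbit of that critical point reaches 0. The second critical
point lies two steps further on the orbit of 0. *)
Lemma multiple_root_orbit n x :
    iter n (horner phi) x = 0 -> (iter_poly phi n)^`().[x] = 0 ->
  exists j, (j < n)%N /\ (orbit0 t (n - j) = 0
    \/ iter j (horner phi) x = c /\ orbit0 t (n - j + 2) = 0).
Proof.
move=> xn; rewrite deriv_iter_poly => /eqP.
rewrite prodf_seq_eq0 => /hasP[j _ /= /eqP dj].
exists j; split=> //.
have split_iter : iter (n - j) (horner phi) (iter j (horner phi) x) = 0.
  by rewrite -iterD subnK // ltnW.
case: (deriv_phi_at_eq0 dj) => yj; rewrite yj in split_iter *; [left | right].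
  by [].
by rewrite -orbit0_iter.
Qed.

Lemma iter_phi_at_separable n x : (forall m, (0 < m)%N -> orbit0 t m != 0) ->
  root (iter_poly phi n) x -> (iter_poly phi n)^`().[x] != 0.
Proof.
move=> orb0 /rootP; rewrite iter_poly_horner => xn; apply/eqP => dx.
case: (multiple_root_orbit xn dx) => j [jn [|[_]]] /eqP; apply/negP/orb0.
  by rewrite subn_gt0.
by rewrite addn2.
Qed.

Section Collision.
Variable n : nat.
Hypotheses (n_gt0 : (0 < n)%N)
  (orb0 : forall m, (0 < m <= n.+1)%N -> orbit0 t m != 0)
  (orbn : orbit0 t n.+2 = 0).

(** If the orbit of 0 first returns to 0 after n + 2 steps, a multiple root can meet
neither 0 nor, after at least one step, c. *)
Lemma collision_multiple_root x : root (iter_poly phi n) x ->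
  (iter_poly phi n)^`().[x] = 0 -> x = c.
Proof.
move=> /rootP; rewrite iter_poly_horner => xn dx.
case: (multiple_root_orbit xn dx) => j [jn [/eqP|[xj]]].
  rewrite (negbTE (orb0 _)) // subn_gt0 jn.
  by rewrite (leq_trans (leq_subr _ _)).
case: j jn xj => // j jn _ /eqP.
rewrite (negbTE (orb0 _)) // addn2 /=.
by rewrite ltnS ltn_subrL n_gt0.
Qed.

Lemma collision_mup : mup c (iter_poly phi n) = 2.
Proof.
have two0 : 2%:R != 0 :> F by rewrite natF0.
have Dn : n = n.-1.+1 by rewrite prednK.
pose Q := (p%:R *: 'X^(p.-2)) * \prod_(j < n.-1) (phi^`() \Po iter_poly phi j.+1).
apply: (@mup_simple_deriv _ _ Q) => //.
- by apply/rootP; rewrite iter_poly_horner orbit0_iter addn2.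
- have -> : (iter_poly phi n)^`() = \prod_(j < n) (phi^`() \Po iter_poly phi j).
    elim: (n) => [|m IHm]; first by rewrite big_ord0 derivX.
    by rewrite big_ord_recr -IHm /iter_poly iterS deriv_comp mulrC.
  rewrite Dn big_ord_recl comp_polyXr {1}deriv_phi_at /Q.
  by rewrite mulrA [_ * ('X - _)]mulrC -!mulrA.
apply/rootP/eqP; rewrite hornerM mulf_neq0 //.
  rewrite hornerZ hornerXn mulf_neq0 ?natF0 ?gtn_eqF // expf_neq0 // orb0 //.
rewrite horner_prod; apply/prodf_neq0 => j _; rewrite horner_comp iter_poly_horner.
have jn : (j.+1 < n)%N by rewrite [X in (_ < X)%N]Dn ltnS.
rewrite orbit0_iter; apply/eqP => /deriv_phi_at_eq0[/eqP|eqc].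
  by rewrite (negbTE (orb0 _)) // addn2.
have : orbit0 t (n - j.+1 + 2) = 0.
  by rewrite -orbit0_iter -eqc orbit0_iter addnA subnK ?addn2 // ltnW.
by move/eqP; rewrite (negbTE (orb0 _)) // addn2 /= ltnS ltn_subrL n_gt0.
Qed.
End Collision.
End Family.

(** * The discriminant of an iterate *)

Section Disc.
Variable p : nat.
Hypotheses (p_prime : prime p) (p_ge3 : (3 <= p)%N).

(** The discriminant of the n-th iterate, up to sign: by the chain rule it is a
product of values of the derivative of phi, and the product of
phi^j(x) - w over the roots x of phi^n is a power of phi^(n-j)(w). *)
Definition disc_value (F : fieldType) (t : F) n : F :=
  \prod_(j < n) (p%:R ^+ (p ^ n) * (orbit0 p t (n - j) ^+ (p ^ j)) ^+ p.-2
                 * orbit0 p t (n - j).+2 ^+ (p ^ j)).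

Lemma disc_value_morph (F F' : fieldType) (f : {rmorphism F -> F'}) t n :
  f (disc_value t n) = disc_value (f t) n.
Proof.
rewrite rmorph_prod; apply: eq_bigr => j _.
by rewrite !rmorphM !rmorphXn !orbit0_morph rmorph_nat.
Qed.

Lemma disc_valueP (W : closedFieldType) (t : W) n (x : 'I_(p ^ n) -> W) :
    phi_den p t != 0 -> [pchar W] =i pred0 ->
    iter_poly (phi_at p t) n = \prod_i ('X - (x i)%:P) ->
  exists b : bool,
    \prod_i \prod_(i' | i' != i) (x i - x i') = (-1) ^+ b * disc_value t n.
Proof.
move=> D0 ch0 Dx; set phi := phi_at p t.
have key (j : 'I_n) w : exists b : bool,
    \prod_i (iter j (horner phi) (x i) - w)
    = (-1) ^+ b * (iter (n - j) (horner phi) w) ^+ (p ^ j).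
  have mon := iter_phi_at_monic p_prime t j.
  have sz := iter_phi_at_size p_prime t j.
  have [||b] := @prod_comp_roots W (iter_poly phi (n - j)) (iter_poly phi j) _ x w mon.
  - by rewrite sz ltnS expn_gt0 prime_gt0.
  - by rewrite -iter_poly_add subnK // ltnW.
  rewrite iter_poly_horner sz /= => h; exists b; rewrite -{}h.
  by apply: eq_bigr => i _; rewrite iter_poly_horner.
under eq_bigr => i _ do rewrite -deriv_prod_XsubC -Dx deriv_iter_poly.
rewrite exchange_big /disc_value.
apply: prod_up_to_sign => j.
under eq_bigr => i _ do rewrite deriv_phi_at_horner // mulrC mulrCA.
rewrite !big_split /= prodr_const card_ord prodrXl.
have [b1 h1] := key j 0; have [b2 h2] := key j (orbit0 p t 2).
have -> : \prod_i iter j (horner phi) (x i) = \prod_i (iter j (horner phi) (x i) - 0).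
  by apply: eq_bigr => i _; rewrite subr0.
rewrite h1 h2 orbit0_iter addn2 exprMn.
exists ((odd p.-2 && b1) (+) b2); rewrite signr_addb.
have -> : (-1) ^+ (odd p.-2 && b1) = ((-1) ^+ b1) ^+ p.-2 :> W.
  by rewrite -exprM -[RHS]signr_odd oddM oddb andbC.
rewrite /orbit0; ring.
Qed.
End Disc.

(** The substitution of x / V makes U monic over the same ring, at the price of
multiplying the roots by V. *)
Lemma monicization (R : idomainType) (U : {poly R}) (V : R) M :
    (0 < M)%N -> size U = M.+1 -> V = lead_coef U ->
  exists P, [/\ P \is monic, P`_0 = V ^+ M.-1 * U`_0
    & forall (S : idomainType) (f : {rmorphism R -> S}) (y : 'I_M -> S),
      f V != 0 -> map_poly f U = f V *: \prod_i ('X - (y i)%:P) ->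
      map_poly f P = \prod_i ('X - (f V * y i)%:P)].
Proof.
move=> M0 szU DV.
pose P := \poly_(i < M.+1) (if i == M then 1 else V ^+ (M.-1 - i) * U`_i).
have PM : P`_M = 1 by rewrite coef_poly ltnSn eqxx.
have szP : size P = M.+1.
  apply/eqP; rewrite eqn_leq size_poly /= leqNgt.
  apply/negP => /leq_sizeP/(_ M (leqnn _)) /eqP.
  by rewrite PM oner_eq0.
exists P; split.
- by rewrite monicE /lead_coef szP PM.
- by rewrite coef_poly /= ltn_eqF // subn0.
move=> S f y fV0 fU; set Q := \prod_i ('X - (f V * y i)%:P).
have QV : Q \Po (f V *: 'X) = f V ^+ M *: \prod_i ('X - (y i)%:P).
  rewrite rmorph_prod -[in f V ^+ M](card_ord M) -prodr_const -scaler_prod.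
  apply: eq_bigr => i _; rewrite rmorphB /= comp_polyX comp_polyC scalerBr.
  by rewrite -[f V *: _%:P]mul_polyC -polyCM.
have coefQ i : f V ^+ i * Q`_i = f V ^+ M * (\prod_i ('X - (y i)%:P))`_i.
  rewrite -[RHS]coefZ -QV coef_comp_poly.
  have [iQ|iQ] := ltnP i (size Q).
    rewrite (bigD1 (Ordinal iQ)) //= exprZn coefZ coefXn eqxx mulr1.
    rewrite big1 ?addr0 1?mulrC // => l.
    by rewrite -val_eqE /= exprZn coefZ coefXn eq_sym => /negbTE ->; rewrite !mulr0.
  rewrite [Q`_i]nth_default // mulr0 big1 // => l _.
  rewrite exprZn coefZ coefXn gtn_eqF ?mulr0 //.
  exact: leq_trans (ltn_ord l) iQ.
have szQ : size Q = M.+1.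
  by rewrite /Q size_prod_XsubC /= [index_enum _]unlock /= -enumT size_enum_ord.
apply/polyP => i; transitivity (f P`_i); first exact: coef_map.
rewrite coef_poly.
have [lt_iM|gt_Mi|->] := ltngtP i M.
- rewrite ltnS ltnW // rmorphM rmorphXn; apply: (mulfI (expf_neq0 i fV0)).
  have fUi : f U`_i = (map_poly f U)`_i by rewrite coef_map.
  rewrite coefQ fUi fU coefZ !mulrA; congr (_ * _).
  by rewrite -exprD -exprSr; congr (_ ^+ _); rewrite subnKC ?prednK // -ltnS prednK.
- by rewrite ltnS leqNgt gt_Mi rmorph0 nth_default // szQ.
- rewrite ltnSn rmorph1.
  have /monicP := monic_prod_XsubC (index_enum 'I_M) xpredT (fun i => f V * y i).
  by rewrite /lead_coef -/Q szQ.
Qed.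

(** * Clearing denominators in the iterates *)

(** Rescaling the roots by a constant changes neither their permutations nor the
labels, so that integral multiples of the roots may be used instead. *)
Lemma root_perms_scale (F : fieldType) (E : splittingFieldType F) M (al : 'I_M -> E)
    (c : F) : c != 0 ->
  root_perms (fun i => c%:A * al i) = root_perms al.
Proof.
move=> c0; have cA0 : c%:A != 0 :> E by rewrite -in_algE fmorph_eq0.
apply/setP=> s; apply/root_permsP/root_permsP => -[g gG gs]; exists g => // i.
  by apply: (mulfI cA0); rewrite -gs rmorphM /= gal_in_alg.
by rewrite rmorphM /= gal_in_alg // gs.
Qed.

Lemma pchar0_galois (F : fieldType) (E : splittingFieldType F) :
  [pchar F] =i pred0 -> galois 1 {:E}.
Proof.
move=> ch0; rewrite /galois sub1v normalFieldf andbT /=.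
apply/separableP => x _; apply: pcharf0_separable => q.
by rewrite -(ch0 q) (fmorph_pchar (in_alg E)).
Qed.

Section ClearedPolynomial.
Variables (p n : nat).
Hypotheses (p_prime : prime p) (p_ge3 : (3 <= p)%N).

Lemma iter_num_poly (F : fieldType) (t : F) : phi_den p t != 0 ->
  iter_num p t%:P 'X n = iter_den p t n *: iter_poly (phi_at p t) n.
Proof.
move=> D0; pose A := phi_num p t / phi_den p t.
have DA : phi_den p t%:P * A%:P = phi_num p t%:P.
  by rewrite -!phi_den_morph -phi_num_morph /= -polyCM mulrC divfK.
rewrite (iter_numE (prime_gt0 p_prime) _ _ DA) -iter_den_morph /= mul_polyC.
congr (_ *: _); rewrite /iter_poly; elim: n => //= m ->.
by rewrite /phi_at !comp_polyD comp_polyM !comp_polyC !comp_Xn_poly.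
Qed.

Lemma iter_phi_at0 (F : fieldType) : iter_poly (phi_at p 0) n = 'X^(p ^ n) :> {poly F}.
Proof.
have -> : phi_at p 0 = 'X^p :> {poly F}.
  rewrite /phi_at /phi_num mulr0 expr0n gtn_eqF ?prime_gt0 //.
  by rewrite mulr0 subr0 mul0r mul0r !addr0.
elim: n => [|m IHm]; first by rewrite expr1.
by rewrite /iter_poly iterS -/(iter_poly _ _) IHm comp_Xn_poly -exprM expnSr.
Qed.

End ClearedPolynomial.

(** * Transitivity and a transposition on every level *)

Lemma mup_prod_XsubC (F : fieldType) M (w : 'I_M -> F) c :
  mup c (\prod_i ('X - (w i)%:P)) = #|[set i | w i == c]|.
Proof.
rewrite -(big_map w xpredT (fun y => 'X - y%:P)) mu_prod_XsubC count_map.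
by rewrite -sum1_count -sum1_card; apply: eq_bigl => i; rewrite inE.
Qed.

Section FunctionField.
Variables (k : fieldType) (p : nat).
Hypotheses (char_k : [pchar k] =i pred0) (p_prime : prime p) (p_ge3 : (3 <= p)%N).
Local Notation K := {fraction {poly k}}.
Local Notation t := (ratfun_t k).
Local Notation j := (@tofrac {poly k} : {rmorphism {poly k} -> K}).

Lemma pchar0_K : [pchar K] =i pred0.
Proof.
move=> q; rewrite -(char_k q).
exact: (fmorph_pchar (j \o polyC : {rmorphism k -> K})).
Qed.

Lemma phi_den_at0 (F : fieldType) : [pchar F] =i pred0 -> phi_den p (0 : F) != 0.
Proof.
have p1 : (0 < p.-1)%N by move: p_ge3; case: (p) => [|[]].
move=> ch0; rewrite /phi_den expr0n gtn_eqF // mulr0 add0r.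
rewrite -[in p%:R](prednK (prime_gt0 p_prime)) -natr1 addrK.
by have /pcharf0P -> := ch0; rewrite -lt0n.
Qed.

Local Notation e0 := (specialize (idfun : {rmorphism k -> k}) 0).

Let e0X : e0 'X = 0.
Proof. by rewrite /= /horner_eval map_polyX hornerX. Qed.

Lemma phi_den_K : phi_den p t != 0.
Proof.
rewrite -(phi_den_morph p j) tofrac_eq0.
apply: contraNneq (phi_den_at0 char_k) => /(congr1 e0).
by rewrite phi_den_morph e0X rmorph0 => ->.
Qed.

Lemma iter_num_zero_factor m : exists2 u : {poly k},
  iter_num p 'X 0 m.+1 = 'X * u & e0 u != 0.
Proof.
have [q Dq] := iter_num_simple_zero (prime_gt0 p_prime) ('X : {poly k}) m p_ge3.
exists (iter_den p 'X m.+1 + 'X * q) => //.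
have -> : e0 (iter_den p 'X m.+1 + 'X * q) = iter_den p 0 m.+1.
  transitivity (e0 (iter_den p 'X m.+1) + e0 'X * e0 q).
    by rewrite rmorphD; congr (_ + _); exact: rmorphM.
  by rewrite e0X mul0r addr0 iter_den_morph e0X.
by rewrite iter_den_neq0 // phi_den_at0.
Qed.

Lemma orbit0_K m : orbit0 p t m = j (iter_num p 'X 0 m) / j (iter_den p 'X m).
Proof.
by rewrite (orbit0_num p_prime phi_den_K) iter_num_morph rmorph0 iter_den_morph.
Qed.

Lemma orbit0_K_neq0 m : (0 < m)%N -> orbit0 p t m != 0.
Proof.
case: m => // m _; have [u Du u0] := iter_num_zero_factor m.
rewrite orbit0_K mulf_neq0 ?invr_eq0 //.
  rewrite tofrac_eq0 Du mulf_neq0 ?polyX_eq0 //.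
  by apply: contraNneq u0 => ->; rewrite rmorph0.
by rewrite iter_den_morph iter_den_neq0 // phi_den_K.
Qed.

Section Level.
Variable n : nat.
Hypothesis n_gt0 : (0 < n)%N.
Local Notation M := (p ^ n)%N.
Local Notation U := (iter_num p ('X : {poly k})%:P 'X n).
Local Notation V := (iter_den p ('X : {poly k}) n).

Lemma map_iter_num (F : fieldType) (f : {rmorphism {poly k} -> F}) :
  phi_den p (f 'X) != 0 -> map_poly f U = f V *: iter_poly (phi_at p (f 'X)) n.
Proof.
move=> D0; rewrite iter_num_morph /= map_polyX map_polyC iter_num_poly //.
by rewrite iter_den_morph.
Qed.

(** An integral model of the n-th iterate, valid for all specializations at which
the denominator of phi does not vanish, with constant coefficient exactly
divisible by t once. *)
Lemma cleared_monic : exists P : {poly {poly k}},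
  [/\ P \is monic, exists2 u, P`_0 = 'X * u & e0 u != 0
   & forall (F : fieldType) (f : {rmorphism {poly k} -> F}) (y : 'I_M -> F),
     phi_den p (f 'X) != 0 -> iter_poly (phi_at p (f 'X)) n = \prod_i ('X - (y i)%:P) ->
     map_poly f P = \prod_i ('X - (f V * y i)%:P)].
Proof.
have M0 : (0 < M)%N by rewrite expn_gt0 prime_gt0.
have jU := map_iter_num (f := j) phi_den_K.
have jV0 : j V != 0 by rewrite iter_den_morph iter_den_neq0 // phi_den_K.
have jinj : injective j := @tofrac_inj {poly k}.
have szU : size U = M.+1.
  have : size (map_poly j U) = size U by apply: size_map_inj_poly; rewrite ?rmorph0.
  by move=> <-; rewrite jU size_scale // iter_phi_at_size.
have lU : V = lead_coef U.
  apply: (jinj).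
  have : lead_coef (map_poly j U) = j (lead_coef U).
    exact: (lead_coef_map_inj jinj (rmorph0 j)).
  move=> <-; rewrite jU lead_coefZ.
  by rewrite (monicP (iter_phi_at_monic p_prime _ _)) mulr1.
have [P [P_mon P0 Pf]] := monicization M0 szU lU.
exists P; split=> //; last first.
  move=> F f y D0 Dy; apply: Pf; first by rewrite iter_den_morph iter_den_neq0.
  by rewrite map_iter_num // Dy.
have U0 : U`_0 = iter_num p 'X 0 n.
  rewrite -horner_coef0 -[U.[0]]/(horner_eval 0 U) iter_num_morph /= /horner_eval.
  by rewrite hornerC hornerX.
have [u Du u0] := iter_num_zero_factor n.-1; rewrite prednK // in Du.
exists (V ^+ M.-1 * u); first by rewrite P0 U0 Du mulrCA.
rewrite rmorphM rmorphXn mulf_neq0 // expf_neq0 //.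
by rewrite iter_den_morph e0X iter_den_neq0 // phi_den_at0.
Qed.

Section Extension.
Variables (E : splittingFieldType K) (W : closedFieldType).
Variables (iota : {rmorphism K -> W}) (inc : {rmorphism E -> W}).
Hypothesis inc_iota : forall a : K, inc a%:A = iota a.
Variable al : 'I_M -> E.
Hypothesis Dal :
  map_poly (in_alg E) (iter_poly (phi_at p t) n) = \prod_i ('X - (al i)%:P).

Let inc_al : iter_poly (phi_at p (iota t)) n = \prod_i ('X - (inc (al i))%:P).
Proof.
rewrite -map_phi_at -map_iter_poly.
have -> : map_poly iota (iter_poly (phi_at p t) n)
        = map_poly inc (map_poly (in_alg E) (iter_poly (phi_at p t) n)).
  by apply/polyP => i; rewrite !coef_map /= inc_iota.
rewrite Dal rmorph_prod; apply: eq_bigr => i _.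
by rewrite rmorphB /= map_polyX map_polyC.
Qed.

Let D0_iota : phi_den p (iota t) != 0.
Proof. by rewrite -phi_den_morph fmorph_eq0 phi_den_K. Qed.

Let ch0_W : [pchar W] =i pred0.
Proof. by move=> q; rewrite -(pchar0_K q) (fmorph_pchar iota). Qed.

(** No iterate of 0 vanishes in k(t), so the iterates of phi are separable. *)
Lemma level_roots_inj : injective al.
Proof.
move=> i i' eq_al; apply/eqP; apply: contraT => ni.
have : (iter_poly (phi_at p (iota t)) n)^`().[inc (al i)] != 0.
  apply: (iter_phi_at_separable p_prime p_ge3 ch0_W D0_iota) => [m m0|].
    by rewrite -orbit0_morph fmorph_eq0 orbit0_K_neq0.
  by rewrite inc_al root_prod_XsubC_mem.
rewrite inc_al deriv_prod_XsubC (bigD1 i') /=; last by rewrite eq_sym.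
by rewrite eq_al subrr mul0r eqxx.
Qed.

Let v := j V.
Let v0 : v != 0.
Proof. by rewrite /v iter_den_morph iter_den_neq0 // phi_den_K. Qed.
Let vA0 : v%:A != 0 :> E.
Proof. by rewrite -in_algE fmorph_eq0. Qed.
Let be i := v%:A * al i.

Let be_inj : injective be.
Proof. by move=> i i' /(mulfI vA0)/level_roots_inj. Qed.

Let Pbe (P : {poly {poly k}}) :
  (forall (F : fieldType) (f : {rmorphism {poly k} -> F}) (y : 'I_M -> F),
     phi_den p (f 'X) != 0 -> iter_poly (phi_at p (f 'X)) n = \prod_i ('X - (y i)%:P) ->
     map_poly f P = \prod_i ('X - (f V * y i)%:P)) ->
  map_poly (in_alg E) (map_poly j P) = \prod_i ('X - (be i)%:P).
Proof.
move=> HP.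
have D0E : phi_den p (in_alg E t) != 0 by rewrite -phi_den_morph fmorph_eq0 phi_den_K.
have DE : iter_poly (phi_at p (in_alg E t)) n = \prod_i ('X - (al i)%:P).
  by rewrite -map_phi_at -map_iter_poly.
by rewrite -map_poly_comp; apply: (HP E (in_alg E \o j) al D0E DE).
Qed.

Lemma level_transitive i1 i2 : exists2 s : 'S_M, s \in root_perms al & s i1 = i2.
Proof.
have [P [P_mon [u P0 u0] HP]] := cleared_monic.
rewrite -(root_perms_scale al v0).
have ker_e0 (r : {poly k}) : e0 r = 0 <-> exists r', r = 'X * r'.
  split=> [|[r' ->]]; last by rewrite rmorphM e0X mul0r.
  rewrite /= /horner_eval map_poly_id // => /rootP/factor_theorem[r' ->].
  by exists r'; rewrite subr0 mulrC.
apply: (@Eisenstein_transitive _ _ _ j e0 'X E M P be u) => //.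
- exact: tofrac_inj.
- exact: poly_integrally_closed.
- by rewrite polyX_eq0.
- exact: pchar0_galois pchar0_K.
- exact: Pbe.
rewrite (HP _ e0 (fun=> 0)).
- by rewrite mulr0 subr0 prodr_const card_ord.
- by rewrite e0X phi_den_at0.
by rewrite e0X iter_phi_at0 // subr0 prodr_const card_ord.
Qed.

(** The discriminant has odd order at tau: among the factors of disc_value, only
the iterate of 0 of index n + 2 vanishes at tau, simply and with exponent
p^0 = 1. *)
Lemma level_transposition : exists i1 i2, i1 != i2 /\ tperm i1 i2 \in root_perms al.
Proof.
have [P [P_mon _ HP]] := cleared_monic.
(* The index n + 2 is the one at which the orbit of the critical point c, which is
   two steps ahead of the orbit of 0, reaches 0 after n steps. *)
have [tau [D0 num0 dnum0 numn0]] := primitive_simple_zero n.+1 p_prime p_ge3 ch0_W.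
pose i0 : {rmorphism k -> W} := iota \o j \o polyC.
pose rho := specialize i0 tau.
have rhoX : rho 'X = tau by rewrite /= /horner_eval map_polyX hornerX.
have orb0 m : (0 < m <= n.+1)%N -> orbit0 p tau m != 0.
  by move=> hm; rewrite orbit0_num // mulf_neq0 ?invr_eq0 ?iter_den_neq0 ?numn0.
have orbn : orbit0 p tau n.+2 = 0 by rewrite orbit0_num // num0 mul0r.
have rhoV0 : rho V != 0 by rewrite iter_den_morph rhoX iter_den_neq0.
have [w Dw] := closed_field_prod_XsubC (iter_phi_at_monic p_prime tau n)
                 (iter_phi_at_size p_prime tau n).
have mupw := collision_mup p_prime p_ge3 ch0_W D0 n_gt0 orb0 orbn.
have multw := collision_multiple_root p_prime p_ge3 ch0_W D0 n_gt0 orb0.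
have [b Db] := disc_valueP p_prime p_ge3 D0_iota ch0_W inc_al.
pose s := \prod_(i < M) \prod_(i' < M | i' != i) v.
pose D := s * ((-1) ^+ b * disc_value p t n).
rewrite -(root_perms_scale al v0).
apply: (@transposition_of_odd_discriminant _ _ _ j rho E M P be
         (fun i => rho V * w i) (rho V * orbit0 p tau 2) D) => //.
- exact: tofrac_inj.
- exact: poly_integrally_closed.
- exact: pchar0_galois pchar0_K.
- exact: Pbe.
- by apply: HP; rewrite rhoX.
- rewrite -mupw Dw mup_prod_XsubC; apply: eq_card => i.
  by rewrite !inE (inj_eq (mulfI rhoV0)).
- move=> i i' /(mulfI rhoV0) eqw; have [->|ni] := eqVneq i i'; [by left | right].
  congr (_ * _); apply: multw.
    by rewrite Dw root_prod_XsubC_mem.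
  by rewrite Dw deriv_prod_XsubC (bigD1 i') 1?eq_sym //= eqw subrr mul0r.
- apply: (fmorph_inj inc); rewrite inc_iota rmorphM rmorphM rmorph_sign.
  rewrite disc_value_morph -Db rmorph_prod [RHS]rmorph_prod -big_split.
  apply: eq_bigr => i _; rewrite [RHS]rmorph_prod rmorph_prod -big_split.
  by apply: eq_bigr => i' _; rewrite -mulrBr rmorphM inc_iota rmorphB.
apply: odd_order_nonsquare.
have oV : order_parity i0 tau v false by apply: order_parity_regular.
have o1 := order_parity1 i0 tau.
have oM z z' : order_parity i0 tau z false -> order_parity i0 tau z' false ->
    order_parity i0 tau (z * z') false by apply: order_parityM.
have oX z m : order_parity i0 tau z false -> order_parity i0 tau (z ^+ m) false.
  by move/(order_parityX m); rewrite andbF.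
have orb m e : (0 < m)%N -> odd (mup tau (map_poly i0 (iter_num p 'X 0 m))) = e ->
    order_parity i0 tau (orbit0 p t m) e.
  move=> m0 De; have nz := orbit0_K_neq0 m0.
  rewrite orbit0_K mulf_eq0 negb_or invr_eq0 !tofrac_eq0 in nz.
  exists (iter_num p 'X 0 m), (iter_den p 'X m); split=> //.
  - by case/andP: nz.
  - by case/andP: nz.
  - exact: orbit0_K.
  - rewrite (@mult_regular _ _ i0 tau (iter_den p 'X m)) ?addn0 //.
    by rewrite iter_den_morph rhoX iter_den_neq0.
have orb_even m : (0 < m <= n.+1)%N -> order_parity i0 tau (orbit0 p t m) false.
  move=> hm; apply: orb; first by case/andP: hm.
  by rewrite mult_regular // iter_num_morph rmorph0 rhoX numn0.
have orb_odd : order_parity i0 tau (orbit0 p t n.+2) true.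
  apply: orb => //; rewrite mult_simple // -/rho.
    by rewrite iter_num_morph rmorph0 rhoX.
  rewrite /rho /= /horner_eval -deriv_map.
  by rewrite [map_poly _ _](iter_num_morph p (map_poly i0)) rmorph0 /= map_polyX.
have op : order_parity i0 tau p%:R false.
  rewrite -(rmorph_nat j); apply: order_parity_regular; rewrite rmorph_nat.
  by have /pcharf0P -> := ch0_W; rewrite gtn_eqF ?prime_gt0.
(* The three factors are the scaling of the roots, the sign and disc_value. *)
rewrite -[true]/(false (+) (false (+) true)); apply: order_parityM.
  apply: (big_ind (fun z => order_parity i0 tau z false)) => // i _.
  by apply: (big_ind (fun z => order_parity i0 tau z false)).
apply: order_parityM.
  rewrite -(rmorph_sign j); apply: order_parity_regular.
  by rewrite rmorph_sign signr_eq0.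
have i10 : nat_of_ord (Ordinal n_gt0) = 0%N by [].
rewrite /disc_value (bigD1 (Ordinal n_gt0)) // i10 subn0 expn0 !expr1.
rewrite -[true]/((false (+) true) (+) false); apply: order_parityM.
  apply: order_parityM => //; apply: (oM); first exact: oX.
  by apply/oX/orb_even; rewrite n_gt0 leqnSn.
apply: (big_ind (fun z => order_parity i0 tau z false)) => // i.
move=> ni; have i_gt0 : (0 < i)%N by move: ni; rewrite -val_eqE /= -lt0n.
apply: (oM); last first.
  by apply/oX/orb_even/andP; split; rewrite // ltnS ltn_subrL n_gt0 i_gt0.
apply: (oM); first exact: oX.
by apply/oX/oX/orb_even; rewrite subn_gt0 ltn_ord (leq_trans (leq_subr _ _)).
Qed.
End Extension.
End Level.
End FunctionField.

(** * Realizing compatible maps level by level *)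

Section Realization.
Variables (k : fieldType) (p : nat).
Hypotheses (char_k : [pchar k] =i pred0) (p_prime : prime p) (p_ge3 : (3 <= p)%N).
Local Notation K := {fraction {poly k}}.
Local Notation t := (ratfun_t k).
Variables (E : splittingFieldType K) (W : closedFieldType).
Variables (iota : {rmorphism K -> W}) (inc : {rmorphism E -> W}).
Hypothesis inc_iota : forall a : K, inc a%:A = iota a.
Local Notation G := 'Gal({:E} / 1)%g.
Local Notation phiE := (phi_at p (in_alg E t)).
Local Notation phiW := (phi_at p (iota t)).
Local Notation level_root m x := (iter m (horner phiE) x == 0).

Lemma map_inc_in_alg (Q : {poly K}) :
  map_poly inc (map_poly (in_alg E) Q) = map_poly iota Q.
Proof. by apply/polyP => i; rewrite !coef_map /= inc_iota. Qed.

Lemma inc_t : inc (in_alg E t) = iota t.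
Proof. exact: inc_iota. Qed.

Lemma map_inc_phi : map_poly inc phiE = phiW.
Proof. by rewrite map_phi_at inc_t. Qed.

Lemma level_rootE m x :
  root (map_poly (in_alg E) (iter_poly (phi_at p t) m)) x = level_root m x.
Proof. by rewrite map_iter_poly map_phi_at /root iter_poly_horner. Qed.

Lemma level_root_inc m x : level_root m x = root (iter_poly phiW m) (inc x).
Proof.
by rewrite /root iter_poly_horner -map_inc_phi -iter_horner_morph fmorph_eq0.
Qed.

Lemma gal_phi (g : gal_of {:E}) x : g \in G -> g phiE.[x] = phiE.[g x].
Proof. by move=> gG; rewrite -horner_map map_phi_at /= gal_in_alg. Qed.

Lemma gal_level_root (g : gal_of {:E}) m x : g \in G ->
  level_root m (g x) = level_root m x.
Proof.
move=> gG; have -> : iter m (horner phiE) (g x) = g (iter m (horner phiE) x).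
  by elim: m => //= m ->; rewrite gal_phi.
by rewrite fmorph_eq0.
Qed.

Section Level.
Variables (m : nat) (al : 'I_(p ^ m.+1) -> E).
Hypothesis Dal :
  map_poly (in_alg E) (iter_poly (phi_at p t) m.+1) = \prod_i ('X - (al i)%:P).
Let al_inj : injective al.
Proof. exact: (level_roots_inj char_k p_prime p_ge3 inc_iota Dal). Qed.

(** Since phi - y divides the separable polynomial with roots al, its p roots are
distinct and lie among them. *)
Lemma sibling_count i : #|[set i' | phiE.[al i'] == phiE.[al i]]| = p.
Proof.
set y := phiE.[al i].
have : phiE - y%:P %| \prod_i ('X - (al i)%:P).
  have : root (iter_poly phiE m) y.
    have : level_root m.+1 (al i) by rewrite -level_rootE codom_root.
    by rewrite /root iter_poly_horner -iterSr.
  case/factor_theorem => q Dq; apply/dvdpP; exists (q \Po phiE).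
  rewrite -Dal map_iter_poly map_phi_at -addn1 iter_poly_add Dq rmorphM.
  by rewrite /iter_poly /= comp_polyXr rmorphB /= comp_polyX comp_polyC.
case/dvdp_prod_XsubC => ms Dms; set r := mask ms _ in Dms.
have r_uniq : uniq r by rewrite mask_uniq // index_enum_uniq.
transitivity #|[set i' in r]|.
  apply: eq_card => i'; rewrite !inE -(mem_map al_inj) -root_prod_XsubC big_map.
  by rewrite -(eqp_root Dms) /root (hornerD phiE) hornerN hornerC subr_eq0.
rewrite cardsE (card_uniqP r_uniq); apply: succn_inj.
rewrite -(size_prod_XsubC r al) -(eqp_size Dms).
rewrite size_polyDl ?phi_at_size ?prednK ?prime_gt0 //.
rewrite size_polyN (leq_ltn_trans (size_polyC_leq1 _)) ?phi_at_size //.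
by rewrite ltnS prime_gt0.
Qed.

Lemma sibling_perm_realized (s : 'S_(p ^ m.+1)) :
    (forall i, phiE.[al (s i)] = phiE.[al i]) ->
  exists2 g, g \in G & forall i, g (al i) = al (s i).
Proof.
move=> ss; apply/root_permsP.
have [i1 [i2 [n12 t12]]] :=
  level_transposition char_k p_prime p_ge3 (ltn0Sn m) inc_iota Dal.
apply: (@sibling_perm_mem _ _ (fun i => phiE.[al i]) (root_perms_group al) p
          p_prime p_ge3 _ _ _ i1 i2) => //.
- exact: (level_transitive char_k p_prime p_ge3 (ltn0Sn m) inc_iota Dal).
- move=> s' i i' /root_permsP[g gG gs] eq_par.
  by rewrite -!gs -!gal_phi // eq_par.
- exact: sibling_count.
Qed.
End Level.

Section Tower.
Variable N : nat.
Hypothesis splitN : exists rs : seq E,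
  map_poly (in_alg E) (iter_poly (phi_at p t) N) %= \prod_(z <- rs) ('X - z%:P).

(** The roots of phi^m are images under phi^(N-m) of roots of phi^N, which lie in E. *)
Lemma level_root_in_image m w : (m <= N)%N ->
  root (iter_poly phiW m) w -> exists x, inc x = w.
Proof.
move=> le_mN mw; have [rs Drs] := splitN.
pose q := iter_poly phiW (N - m).
have szq : size q = (p ^ (N - m)).+1 by apply: iter_phi_at_size.
(* A preimage of w under phi^(N-m) is a root of phi^N. *)
have [u] : exists u, root (q - w%:P) u.
  apply/closed_rootP; rewrite size_polyDl szq.
    by rewrite eqSS -lt0n expn_gt0 prime_gt0.
  by rewrite size_polyN (leq_ltn_trans (size_polyC_leq1 _)) // ltnS expn_gt0 prime_gt0.
rewrite /root hornerD hornerN hornerC subr_eq0 => qu.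
have : root (map_poly inc (map_poly (in_alg E) (iter_poly (phi_at p t) N))) u.
  rewrite map_inc_in_alg map_iter_poly map_phi_at -(subnKC le_mN) iter_poly_add.
  by rewrite /root horner_comp -/q (eqP qu).
rewrite (eqp_root (_ : _ %= map_poly inc (\prod_(z <- rs) ('X - z%:P)))) ?eqp_map //.
rewrite rmorph_prod (eq_bigr (fun z => 'X - (inc z)%:P)) => [|z _]; last first.
  by rewrite rmorphB /= map_polyX map_polyC.
rewrite -(big_map inc xpredT (fun z => 'X - z%:P)) root_prod_XsubC.
case/mapP => z _ uz; exists (iter (N - m) (horner phiE) z).
by rewrite iter_horner_morph map_inc_phi -uz -iter_poly_horner (eqP qu).
Qed.

Lemma level_splits m : (m <= N)%N -> exists al : 'I_(p ^ m) -> E,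
  map_poly (in_alg E) (iter_poly (phi_at p t) m) = \prod_i ('X - (al i)%:P).
Proof.
move=> le_mN.
have [w Dw] := closed_field_prod_XsubC (iter_phi_at_monic p_prime (iota t) m)
                 (iter_phi_at_size p_prime (iota t) m).
have /fin_all_exists[al Dal] i : exists x, inc x = w i.
  apply: (level_root_in_image le_mN).
  by rewrite Dw root_prod_XsubC_mem.
exists al; apply: (map_poly_inj inc).
rewrite map_inc_in_alg map_iter_poly map_phi_at Dw rmorph_prod.
by apply: eq_bigr => i _; rewrite rmorphB /= map_polyX map_polyC /= Dal.
Qed.

(** By induction on the level: after composition with the inverse of a Galois
element that agrees with f on level m, what f does on level m + 1 permutes
siblings, and every such permutation is Galois. *)
Lemma compatible_maps_realized (f : nat -> E -> E) :
    (forall m x, (m <= N)%N -> level_root m x -> level_root m (f m x)) ->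
    (forall m x y, (m <= N)%N -> level_root m x -> level_root m y ->
       f m x = f m y -> x = y) ->
    (forall m x, (m < N)%N -> level_root m.+1 x ->
       phiE.[f m.+1 x] = f m phiE.[x]) ->
  forall m, (m <= N)%N ->
  exists2 g, g \in G & forall x, level_root m x -> g x = f m x.
Proof.
move=> f_root f_inj f_phi; elim=> [|m IHm] le_mN.
  exists 1%g => // x x0; rewrite gal_id.
  exact: etrans (eqP x0) (esym (eqP (f_root 0%N x le_mN x0))).
have [g gG gf] := IHm (ltnW le_mN).
have [al Dal] := level_splits le_mN.
have al_inj := level_roots_inj char_k p_prime p_ge3 inc_iota Dal.
have al_root i : level_root m.+1 (al i) by rewrite -level_rootE (codom_root Dal).
have gV x : (g^-1)%g (g x) = x by rewrite -galM ?memvf // mulgV gal_id.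
have gK x : g ((g^-1)%g x) = x by rewrite -galM ?memvf // mulVg gal_id.
have gVG : (g^-1)%g \in G by rewrite groupV.
have /fin_all_exists[s Ds] i : exists i', (g^-1)%g (f m.+1 (al i)) = al i'.
  apply: (root_in_codom Dal).
  by rewrite level_rootE gal_level_root // f_root.
have s_inj : injective s.
  move=> i i' eq_s; apply: al_inj; apply: (f_inj _ _ _ le_mN (al_root i) (al_root i')).
  by rewrite -[LHS]gK -[RHS]gK !Ds eq_s.
have [|h hG Dh] := @sibling_perm_realized m al Dal (perm s_inj).
  move=> i; rewrite permE -Ds -gal_phi // f_phi // -gf ?gV //.
  by rewrite -iterSr.
exists (h * g)%g; first exact: groupM.
move=> x; rewrite -level_rootE => /(root_in_codom Dal)[i ->].
by rewrite galM ?memvf // Dh permE -Ds gK.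
Qed.
End Tower.
End Realization.

(** * Combinatorics of the preimage tree *)

Section TreeCombinatorics.
Variables (K : fieldType) (W : closedFieldType) (iota : {rmorphism K -> W}).
Variable phi : {poly K}.
Hypothesis phi_size : (1 < size phi)%N.
Local Notation tree := (tree_vertex iota phi).
Local Notation phiW := (map_poly iota phi).
Implicit Types (u v : tree).

Lemma vertex_eq u v : level u = level v -> point u = point v -> u = v.
Proof.
move=> lu pu; apply: val_inj.
by move: lu pu; rewrite /level /point; case: (val u) (val v) => [l x] [l' x'] /= -> ->.
Qed.

Lemma level_root_iter v : iter (level v) (horner phiW) (point v) = 0.
Proof. by rewrite -iter_poly_horner -map_iter_poly; apply/rootP/(valP v). Qed.

Lemma mk_vertex n x : iter n (horner phiW) x = 0 ->
  {v : tree | level v = n & point v = x}.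
Proof.
move=> nx; have v : is_vertex iota phi (n, x).
  by rewrite /is_vertex /= map_iter_poly /root iter_poly_horner nx.
by exists (exist _ (n, x) v).
Qed.

Lemma has_parent u n : level u = n.+1 -> exists2 v, level v = n & child_of u v.
Proof.
move=> lu; have [|v lv pv] := @mk_vertex n phiW.[point u].
  by rewrite -iterSr -lu level_root_iter.
by exists v; rewrite // /child_of lu lv pv !eqxx.
Qed.

Lemma parent_uniq u v v' : child_of u v -> child_of u v' -> v = v'.
Proof.
case/andP=> /eqP lv /eqP pv /andP[/eqP lv' /eqP pv'].
by apply: vertex_eq; [apply: succn_inj; rewrite -lv -lv' | rewrite pv pv'].
Qed.

Lemma has_child v : exists u, child_of u v.
Proof.
have [x] : exists x, root (phiW - (point v)%:P) x.
  apply/closed_rootP; rewrite size_polyDl size_map_poly ?gtn_eqF //.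
  by rewrite size_polyN (leq_ltn_trans (size_polyC_leq1 _)).
rewrite /root hornerD hornerN hornerC subr_eq0 => /eqP xv.
have [|u lu pu] := @mk_vertex (level v).+1 x.
  by rewrite iterSr xv level_root_iter.
by exists u; rewrite /child_of lu pu xv !eqxx.
Qed.

Lemma level0_root v : level v = 0%N -> v = tree_root iota phi.
Proof.
move=> lv; apply: vertex_eq => //.
by have := level_root_iter v; rewrite lv.
Qed.

Section Automorphism.
Variable f : tree -> tree.
Hypothesis f_aut : tree_automorphism f.

Let f_inj : injective f.
Proof. by case: f_aut => /bij_inj. Qed.

(** A neighbour of u is either a child or the parent of u. By induction the parent v
of u goes to level n, so f u is a child of f v unless it is the parent of f v;
the latter is already the image of the parent of v. *)
Lemma automorphism_level_child n u : level u = n ->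
  level (f u) = n /\ forall v, child_of u v -> child_of (f u) (f v).
Proof.
have [_ f0 f_adj] := f_aut; elim: n u => [|n IHn] u lu.
  split; first by rewrite (level0_root lu) f0.
  by move=> v /andP[]; rewrite lu.
have child_f v : child_of u v -> child_of (f u) (f v).
  move=> cuv; have lv : level v = n.
    by case/andP: (cuv); rewrite lu eqSS => /eqP.
  have [lfv IHv] := IHn v lv.
  have : adjacent (f u) (f v) by rewrite f_adj /adjacent cuv.
  case/orP => // cfvu; exfalso.
  have /andP[/eqP] := cfvu; rewrite lfv => ln _.
  have [v' _ cvv'] : exists2 v', level v' = level (f u) & child_of v v'.
    by apply: has_parent; rewrite lv ln.
  have /f_inj uv' := parent_uniq cfvu (IHv v' cvv').
  by case/andP: cvv' => /eqP; rewrite -uv' lv lu; elim: (n) => // l IHl [/IHl].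
split=> //; have [v lv cuv] := has_parent lu.
by have /andP[/eqP -> _] := child_f v cuv; rewrite (IHn v lv).1.
Qed.

Lemma automorphism_level u : level (f u) = level u.
Proof. by case: (automorphism_level_child (erefl (level u))). Qed.

Lemma automorphism_child u v : child_of u v -> child_of (f u) (f v).
Proof. by case: (automorphism_level_child (erefl (level u))) => _; apply. Qed.
End Automorphism.
End TreeCombinatorics.

(** The elements of a finite extension are polynomials in its generators. *)
Lemma adjoin_seq_ind (F : fieldType) (E : splittingFieldType F) (S : E -> Prop)
    (rs : seq E) :
    (forall a : F, S a%:A) -> (forall x y, S x -> S y -> S (x + y)) ->
    (forall x y, S x -> S y -> S (x * y)) -> (forall x, x \in rs -> S x) ->
  forall x, x \in <<1 & rs>>%VS -> S x.
Proof.
move=> Sa SD SM; elim/last_ind: rs => [|rs z IHrs] Srs x.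
  by rewrite Fadjoin_nil => /vlineP[a ->].
rewrite adjoin_rcons => /Fadjoin_polyP[q /polyOverP q_over ->].
have S0 : S 0 by rewrite -(scale0r 1); apply: Sa.
have S1 : S 1 by rewrite -(scale1r 1); apply: Sa.
have Sz : S z by apply: Srs; rewrite mem_rcons mem_head.
rewrite horner_coef; apply: (big_ind S) => // i _; apply: (SM).
  apply: IHrs => // y y_rs; apply: Srs.
  by rewrite mem_rcons inE y_rs orbT.
by elim: (nat_of_ord i) => [|l IHl]; rewrite ?expr0 // exprS; apply: SM.
Qed.

(** * The arboreal representation *)

Section Arboreal.
Variables (k : fieldType) (p : nat).
Hypotheses (char_k : [pchar k] =i pred0) (p_prime : prime p) (p_ge3 : (3 <= p)%N).
Variables (W : closedFieldType) (iota : {rmorphism {fraction {poly k}} -> W}).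
Local Notation K := {fraction {poly k}}.
Local Notation t := (ratfun_t k).
Local Notation phi := (phi_at p t).
Local Notation phiW := (map_poly iota phi).
Local Notation tree := (tree_vertex iota phi).

Lemma discriminant_neq0 n : (0 < n)%N -> discriminant (iter_poly phi n) != 0.
Proof.
move=> n0; set P := iter_poly phi n.
have P_mon : P \is monic by apply: iter_phi_at_monic.
rewrite /discriminant (monicP P_mon) divr1 mulf_neq0 ?signr_eq0 //.
rewrite resultant_eq0 -leqNgt leqNgt; apply/negP => gcd1.
have [x] : exists x, root (map_poly iota (gcdp P P^`())) x.
  by apply/closed_rootP; rewrite size_map_poly gtn_eqF.
rewrite gcdp_map root_gcd => /andP[Px /rootP dPx].
have D0 : phi_den p (iota t) != 0 by rewrite -phi_den_morph fmorph_eq0 phi_den_K.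
have ch0_W : [pchar W] =i pred0.
  by move=> q; rewrite -(pchar0_K char_k q) (fmorph_pchar iota).
rewrite map_iter_poly map_phi_at in Px.
have : (iter_poly (phi_at p (iota t)) n)^`().[x] != 0.
  apply: (iter_phi_at_separable p_prime p_ge3 ch0_W D0) => // m m0.
  by rewrite -orbit0_morph fmorph_eq0 orbit0_K_neq0.
by rewrite -map_phi_at -map_iter_poly deriv_map dPx eqxx.
Qed.

Variable L : splitting_tower iota phi.
Local Notation inc := (Kn_incl L).
Local Notation G n := 'Gal({:Kn L n} / 1)%g.

Let phi_size : (1 < size phi)%N. Proof. by rewrite phi_at_size. Qed.

Lemma tower_split N : exists rs : seq (Kn L N),
  map_poly (in_alg (Kn L N)) (iter_poly phi N) %= \prod_(z <- rs) ('X - z%:P).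
Proof. by have [rs Drs _] := Kn_split L N; exists rs. Qed.

Let inc_iota N (a : K) : inc N a%:A = iota a. Proof. exact: Kn_inclA. Qed.

Lemma inc_phi N (x : Kn L N) :
  inc N (phi_at p (in_alg (Kn L N) t)).[x] = phiW.[inc N x].
Proof. by rewrite map_phi_at -(map_inc_phi p (@inc_iota N)) horner_map. Qed.

Lemma inc_level_root N m (x : Kn L N) :
  (iter m (horner (phi_at p (in_alg (Kn L N) t))) x == 0)
  = (iter m (horner phiW) (inc N x) == 0).
Proof.
by rewrite (level_root_inc _ (@inc_iota N)) /root iter_poly_horner map_phi_at.
Qed.

Lemma vertex_in_image N (v : tree) : (level v <= N)%N -> exists x, inc N x = point v.
Proof.
move=> lv; apply: (level_root_in_image p_prime (@inc_iota N) (tower_split N) lv).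
by rewrite /root iter_poly_horner -map_phi_at level_root_iter.
Qed.

Lemma vertex_coord n (v : tree) : level v = n -> exists x, inc n x = point v.
Proof. by move=> lv; apply: vertex_in_image; rewrite lv. Qed.

Section ImageIsAutomorphism.
Variables (g : arboreal_group L) (f : tree -> tree).
Hypothesis gf : acts_as g f.
Local Notation s := (gal_comp g).

Lemma acts_asE n (v : tree) (x : Kn L n) : level v = n -> inc n x = point v ->
  level (f v) = n /\ point (f v) = inc n (s n x).
Proof.
move=> lv; subst n => xv; have [lfv [y yv ->]] := gf v; split=> //.
by congr (inc _ (s _ _)); apply: (fmorph_inj (inc (level v))); rewrite yv xv.
Qed.

Let f_inj : injective f.
Proof.
move=> u v fuv.
have [x xu] := vertex_coord (erefl (level u)).
have [lfu pfu] := acts_asE (erefl _) xu.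
have [y yv] := vertex_coord (erefl (level v)).
have [lfv pfv] := acts_asE (erefl _) yv.
have luv : level v = level u by rewrite -lfu -lfv fuv.
have [x' x'v] := vertex_coord luv; have [_ pfv'] := acts_asE luv x'v.
apply: vertex_eq => //; rewrite -xu -x'v; congr (inc _ _).
apply: (fmorph_inj (s (level u))); apply: (fmorph_inj (inc (level u))).
by rewrite [LHS](_ : _ = point (f u)) // [RHS](_ : _ = point (f v)) ?fuv.
Qed.

Let f_surj w : exists v, f v == w.
Proof.
have [y yw] := vertex_coord (erefl (level w)).
set n := level w in y yw; have sG := gal_compP g n.
have sVG : ((s n)^-1)%g \in G n by rewrite groupV.
have sK x : s n (((s n)^-1)%g x) = x by rewrite -galM ?memvf // mulVg gal_id.
have [|v lv pv] := @mk_vertex _ _ iota phi n (inc n (((s n)^-1)%g y)).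
  apply/eqP; rewrite -inc_level_root gal_level_root // inc_level_root yw.
  by rewrite level_root_iter.
have [lfv pfv] := acts_asE lv (esym pv).
by exists v; apply/eqP/vertex_eq; rewrite ?lfv // pfv sK yw.
Qed.

Let f_bij : bijective f.
Proof.
exists (fun w => xchoose (f_surj w)) => [v|w]; last exact: (eqP (xchooseP (f_surj w))).
by apply: f_inj; exact: (eqP (xchooseP (f_surj (f v)))).
Qed.

Let f_child u v : child_of (f u) (f v) = child_of u v.
Proof.
have [x xu] := vertex_coord (erefl (level u)).
have [lfu pfu] := acts_asE (erefl _) xu.
have [y yv] := vertex_coord (erefl (level v)).
have [lfv pfv] := acts_asE (erefl _) yv.
rewrite /child_of lfu lfv; case: eqP => //= luv.
have [x' x'u] := vertex_coord luv.
have [_ pfu'] := acts_asE luv x'u.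
set n := level v in y yv lfv pfv luv x' x'u pfu' *.
have sG := gal_compP g n.+1.
have phi_fu : phiW.[point (f u)]
    = inc n.+1 (s n.+1 (phi_at p (in_alg (Kn L n.+1) t)).[x']).
  by rewrite gal_phi // inc_phi pfu'.
have phi_u : phiW.[point u] = inc n.+1 (phi_at p (in_alg (Kn L n.+1) t)).[x'].
  by rewrite inc_phi x'u.
have [|w lw pw] := @mk_vertex _ _ iota phi n phiW.[point u].
  by rewrite -iterSr -luv level_root_iter.
have [z zw] := vertex_coord lw.
have e1 : phiW.[point (f u)] = inc n (s n z).
  by rewrite phi_fu; apply: gal_coherent; rewrite -phi_u -pw zw.
have e2 : phiW.[point u] = inc n z by rewrite zw pw.
by rewrite e1 e2 pfv -yv !(inj_eq (fmorph_inj _)).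
Qed.

Lemma image_automorphism : tree_automorphism f.
Proof.
split; first exact: f_bij.
  apply: level0_root.
  have [x xr] := vertex_coord (erefl (level (tree_root iota phi))).
  by have [] := acts_asE (erefl _) xr.
by move=> u v; rewrite /adjacent !f_child.
Qed.
End ImageIsAutomorphism.

Section AutomorphismInImage.
Variable f : tree -> tree.
Hypothesis f_aut : tree_automorphism f.

Let f_inj : injective f. Proof. by case: f_aut => /bij_inj. Qed.

(** The action of f on points depends on the level of the vertex above which they
are considered, hence the family F indexed by levels. *)
Lemma automorphism_realized N : exists g, g \in G N /\
  forall (v : tree) x, level v = N -> inc N x = point v -> inc N (g x) = point (f v).
Proof.
pose E := Kn L N; pose phiE := phi_at p (in_alg E t).
pose act m (x y : E) := forall v : tree, level v = m -> point v = inc N x ->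
  inc N y = point (f v).
have act_ex m x : exists y, (m <= N)%N -> iter m (horner phiE) x == 0 -> act m x y.
  have [/andP[le_mN xm]|nh] := boolP ((m <= N)%N && (iter m (horner phiE) x == 0)).
    rewrite inc_level_root in xm; have [v lv pv] := mk_vertex (eqP xm).
    have [|y yfv] := @vertex_in_image N (f v).
      by rewrite automorphism_level // lv.
    exists y => _ _ u lu pu; rewrite yfv; congr (point (f _)).
    by apply: vertex_eq; rewrite ?lu ?lv ?pu.
  by exists 0 => le_mN xm; rewrite le_mN xm in nh.
pose F m x := proj1_sig (constructive_indefinite_description _ (act_ex m x)).
have FP m x : (m <= N)%N -> iter m (horner phiE) x == 0 -> act m x (F m x).
  exact: (proj2_sig (constructive_indefinite_description _ (act_ex m x))).
have vtx m x : iter m (horner phiE) x == 0 ->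
    {v : tree | level v = m & point v = inc N x}.
  by move=> xm; apply: mk_vertex; apply/eqP; rewrite -inc_level_root.
have [|||g gG gF] := @compatible_maps_realized k p char_k p_prime p_ge3 E W iota
  (inc N) (@inc_iota N) N (tower_split N) F _ _ _ N (leqnn N).
- move=> m x le_mN xm; have [v lv pv] := vtx m x xm.
  rewrite inc_level_root (FP m x le_mN xm v lv pv) -lv -(automorphism_level f_aut).
  by rewrite level_root_iter.
- move=> m x y le_mN xm ym eqF.
  have [v lv pv] := vtx m x xm; have [w lw pw] := vtx m y ym.
  apply: (fmorph_inj (inc N)); rewrite -pv -pw; congr point; apply: f_inj.
  apply: vertex_eq; first by rewrite !(automorphism_level f_aut) lv lw.
  by rewrite -(FP m x le_mN xm v lv pv) -(FP m y le_mN ym w lw pw) eqF.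
- move=> m x lt_mN xm; have [u lu pu] := vtx m.+1 x xm.
  have xm' : iter m (horner phiE) phiE.[x] == 0 by rewrite -iterSr.
  have [v lv pv] := vtx m _ xm'.
  have cuv : child_of u v by rewrite /child_of lu lv pv inc_phi pu !eqxx.
  apply: (fmorph_inj (inc N)); rewrite inc_phi (FP m.+1 x lt_mN xm u lu pu).
  rewrite (FP m _ (ltnW lt_mN) xm' v lv pv).
  by have /andP[_ /eqP ->] := automorphism_child f_aut cuv.
exists g; split=> // v x lv xv; have xN : iter N (horner phiE) x == 0.
  by rewrite inc_level_root xv -lv level_root_iter.
by rewrite gF // (FP N x (leqnn N) xN v lv (esym xv)).
Qed.

(** Coherence holds on the roots of phi^n, because they are images under phi of roots
of phi^(n+1) and f preserves children; it extends to the field that they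
generate. *)
Lemma automorphism_in_image : arboreal_image L f.
Proof.
pose g n : gal_of {:Kn L n} :=
  proj1_sig (constructive_indefinite_description _ (automorphism_realized n)).
have gG n : g n \in G n.
  by rewrite /g; case: constructive_indefinite_description => h [].
have gf n (v : tree) x :
    level v = n -> inc n x = point v -> inc n (g n x) = point (f v).
  by rewrite /g; case: constructive_indefinite_description => h [_ hf] /=; apply: hf.
have coh n (x : Kn L n) (y : Kn L n.+1) :
    inc n.+1 y = inc n x -> inc n.+1 (g n.+1 y) = inc n (g n x).
  pose S (x : Kn L n) := exists2 y, inc n.+1 y = inc n x &
    inc n.+1 (g n.+1 y) = inc n (g n x).
  suff Sx z : S z.
    have [y' y'x gy'x] := Sx x.
    move=> yx; rewrite -gy'x; congr (inc _ (g _ _)).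
    by apply: (fmorph_inj (inc n.+1)); rewrite yx y'x.
  have [rs Drs full] := Kn_split L n.
  have : z \in <<1 & rs>>%VS by rewrite full memvf.
  apply: adjoin_seq_ind => [a|x1 x2|x1 x2|r r_rs].
  - have ea : inc n.+1 a%:A = inc n a%:A.
      by apply: etrans (Kn_inclA L n.+1 a) _; apply: esym (Kn_inclA L n a).
    exists a%:A => //.
    have e1 : g n.+1 a%:A = a%:A by exact: (gal_in_alg a (gG _)).
    have e2 : g n a%:A = a%:A by exact: (gal_in_alg a (gG _)).
    by rewrite e1 e2.
  - case=> y1 y1x gy1 [y2 y2x gy2]; exists (y1 + y2);
      by rewrite !rmorphD /= ?y1x ?y2x ?gy1 ?gy2.
  - case=> y1 y1x gy1 [y2 y2x gy2]; exists (y1 * y2);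
      by rewrite !rmorphM /= ?y1x ?y2x ?gy1 ?gy2.
  have r0 : iter n (horner (phi_at p (in_alg (Kn L n) t))) r == 0.
    by rewrite -level_rootE (eqp_root Drs) root_prod_XsubC.
  have [|v lv pv] := @mk_vertex _ _ iota phi n (inc n r).
    by apply/eqP; rewrite -inc_level_root.
  have [u cuv] := has_child phi_size v.
  have lu : level u = n.+1 by have /andP[/eqP -> _] := cuv; rewrite lv.
  have [x1 x1u] := vertex_coord lu.
  pose y1 := (phi_at p (in_alg (Kn L n.+1) t)).[x1].
  have y1E : inc n.+1 y1 = phiW.[point u] by rewrite inc_phi x1u.
  have gy1E : inc n.+1 (g n.+1 y1) = phiW.[point (f u)].
    have -> : g n.+1 y1 = (phi_at p (in_alg (Kn L n.+1) t)).[g n.+1 x1].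
      by apply: gal_phi; apply: gG.
    by rewrite inc_phi (gf _ u).
  exists y1; first by apply: etrans y1E _; rewrite -pv; have /andP[_ /eqP ->] := cuv.
  apply: etrans gy1E _; rewrite (gf n v) //.
  by have /andP[_ /eqP ->] := automorphism_child f_aut cuv.
exists (ArborealGroup gG coh) => v; split; first exact: automorphism_level.
have [x xv] := vertex_coord (erefl (level v)); exists x => //.
by rewrite /= (gf _ v).
Qed.
End AutomorphismInImage.
End Arboreal.

Theorem theorem1p4 (k : fieldType) (char_k : [pchar k] =i pred0)
    (p : nat) (p_prime : prime p) (p_ge3 : (3 <= p)%N)
    (Kbar : closedFieldType)
    (iota : {rmorphism {fraction {poly k}} -> Kbar})
    (Kbar_algebraic : forall z : Kbar, algebraicOver iota z)
    (L : splitting_tower iota (phi_p k p)) :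
  (forall n : nat, (1 <= n)%N -> discriminant (iter_poly (phi_p k p) n) != 0) /\
  (forall f : tree_vertex iota (phi_p k p) -> tree_vertex iota (phi_p k p),
     arboreal_image L f <-> tree_automorphism f).
Proof.
split=> [n n_gt0|f]; first exact: (discriminant_neq0 char_k p_prime p_ge3 iota).
split=> [[g gf]|f_aut].
  exact: (image_automorphism p_prime gf).
exact: (@automorphism_in_image k p char_k p_prime p_ge3 Kbar iota L f f_aut).
Qed.
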